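(* Let $n\ge1$. Suppose a depth-$d$ $\mathrm{QAC}^0$ circuit $U$ with $n$ input qubits and $a$ ancilla qubits initialized in a state $\varphi$ computes a function $f:\{0,1\}^n\to\{0,1\}$ with worst-case probability $1-\delta$. Then for $\varepsilon=\delta+O(d/n)$, $$\deg_\varepsilon(f)=\tilde O\big((n+a)^{1-3^{-d}}\big).$$ Moreover, if $f=f_n$ satisfies $\deg_{1/3}(f_n)=\Omega(n)$ and there is a depth-$d$ $\mathrm{QAC}^0$ circuit with $n$ input qubits and $a=a_n$ ancillae computing $f_n$ with worst-case error at most a constant strictly below $1/2$, then $a=\tilde\Omega\big(n^{1+3^{-d}}\big)$.
   Context: A depth-$d$ $\mathrm{QAC}^0$ circuit on $m$ qubits is a unitary $U=L_dM_d\cdots L_1M_1L_0$ where each $L_i$ is a tensor product of single-qubit unitaries and each $M_i$ is a tensor product of multi-qubit CZ gates $I-2|1^s\rangle\langle1^s|$ on pairwise disjoint sets of qubits. On input $x\in\{0,1\}^n$ the circuit produces $U(|x\rangle\langle x|\otimes\varphi)U^\dagger$ and measures the first qubit in the computational basis; the outcome is $C_U(x)$. It computes $f$ with worst-case probability $1-\delta$ (worst-case error $\delta$) if $\Pr[C_U(x)\ne f(x)]\le\delta$ for all $x$. For $f:\{0,1\}^n\to\mathbb R$ with Fourier expansion $f=\sum_S\hat f(S)\chi_S$, $\chi_S(x)=(-1)^{\sum_{i\in S}x_i}$: $\deg(f)=\max\{|S|:\hat f(S)\ne0\}$, $\deg_\varepsilon(f)=\min\{\deg(g):\max_x|f(x)-g(x)|\le\varepsilon\}$.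 $O$ hides absolute constants; $\tilde O,\tilde\Omega$ additionally hide polylogarithmic factors. *)

(* Defs.v *)
From HB Require Import structures.
From mathcomp Require Import all_boot all_order all_algebra.
From mathcomp Require Import spectral.
From mathcomp Require Import complex.
From mathcomp Require Import reals.

Set Implicit Arguments.
Unset Strict Implicit.
Unset Printing Implicit Defensive.

Import Order.TTheory GRing.Theory Num.Theory.
Local Open Scope ring_scope.

(* A system of m qubits has Hilbert space C^(2^m); the computational basis    *)
(* vector with index i (0 <= i < 2^m) has qubit j (0 <= j < m) equal to the   *)
(* j-th binary digit of i (qubit 0 = least significant bit).                  *)

Definition bitn (i j : nat) : bool := odd (i %/ 2 ^ j).

Definition b2I (b : bool) : 'I_2 := inord b.

Definition bits (n : nat) := {ffun 'I_n -> bool}.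

Definition bits_num n (x : bits n) : nat := \sum_(j < n) x j * 2 ^ j.

Section Quantum.
Variable R : realType.
Local Notation C := R[i].

Definition dagger p q (M : 'M[C]_(p, q)) : 'M[C]_(q, p) := map_mx Num.conj M^T.

(* Tensor product u_0 (x) u_1 (x) ... (x) u_(m-1) of single-qubit operators,  *)
(* u_j acting on qubit j.                                                     *)
Definition layer1 m (u : 'I_m -> 'M[C]_2) : 'M[C]_(2 ^ m) :=
  \matrix_(i, k) \prod_(j < m) u j (b2I (bitn i j)) (b2I (bitn k j)).

(* Tensor product of the multi-qubit CZ gates I - 2|1^s><1^s| on the sets of  *)
(* qubits S in P (and identity elsewhere).                                    *)
Definition czlayer m (P : {set {set 'I_m}}) : 'M[C]_(2 ^ m) :=
  diag_mx (\row_(i < 2 ^ m)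
    \prod_(S in P) (if [forall j in S, bitn i j] then -1 else 1)).

Definition cz_layer_ok m (P : {set {set 'I_m}}) : Prop :=
  trivIset P /\ set0 \notin P.

(* Data of a depth-d QAC0 circuit on m qubits:                                *)
(* U = L_d M_d ... L_1 M_1 L_0, with L_t = (x)_j Lay t j, M_t = czlayer (CZ t). *)
Record qac0 (m d : nat) := QAC0 {
  Lay : nat -> 'I_m -> 'M[C]_2;
  CZ  : nat -> {set {set 'I_m}} }.

Definition qac0_ok m d (c : qac0 m d) : Prop :=
  (forall t j, (t <= d)%N -> Lay c t j \is unitarymx) /\
  (forall t, (1 <= t <= d)%N -> cz_layer_ok (CZ c t)).

Fixpoint circ_upto m d (c : qac0 m d) (t : nat) : 'M[C]_(2 ^ m) :=
  match t with
  | 0 => layer1 (Lay c 0)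
  | t'.+1 => layer1 (Lay c t) *m czlayer (CZ c t) *m circ_upto c t'
  end.

Definition circ_unitary m d (c : qac0 m d) : 'M[C]_(2 ^ m) := circ_upto c d.

Definition is_state k (phi : 'M[C]_k) : Prop :=
  dagger phi = phi /\
  (forall v : 'rV[C]_k, 0 <= (v *m phi *m dagger v) 0 0) /\
  \tr phi = 1.

(* The input state |x><x| (x) phi on n + a qubits: the n input qubits are     *)
(* qubits 0..n-1, the a ancilla qubits are qubits n..n+a-1.                   *)
Definition input_state n a (x : bits n) (phi : 'M[C]_(2 ^ a))
  : 'M[C]_(2 ^ (n + a)) :=
  \matrix_(i < 2 ^ (n + a), i' < 2 ^ (n + a)) \sum_(k < 2 ^ a) \sum_(k' < 2 ^ a)
     (if (val i == bits_num x + 2 ^ n * k)%N && (val i' == bits_num x + 2 ^ n * k')%N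
      then phi k k' else 0).

Definition out_prob n a d (c : qac0 (n + a) d) (phi : 'M[C]_(2 ^ a))
  (x : bits n) (b : bool) : R :=
  let U := circ_unitary c in
  let rho := U *m input_state x phi *m dagger U in
  complex.Re (\sum_(i < 2 ^ (n + a) | bitn i 0 == b) rho i i).

Definition computes_with_error n a d (c : qac0 (n + a) d)
  (phi : 'M[C]_(2 ^ a)) (f : bits n -> bool) (delta : R) : Prop :=
  forall x : bits n, out_prob c phi x (~~ f x) <= delta.

End Quantum.

Section Fourier.
Variable R : realType.

Definition chi n (S : {set 'I_n}) (x : bits n) : R :=
  (-1) ^+ #|[set j in S | x j]|.

Definition fourier n (g : bits n -> R) (S : {set 'I_n}) : R :=
  ((2 ^ n)%:R)^-1 * \sum_(x : bits n) g x * chi S x.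

(* deg(g) = max{|S| : hat g(S) <> 0} (0 for g = 0). *)
Definition fdeg n (g : bits n -> R) : nat :=
  \max_(S : {set 'I_n} | fourier g S != 0) #|S|.

Definition approx_deg_le n (eps : R) (f : bits n -> bool) (B : R) : Prop :=
  exists g : bits n -> R,
    (fdeg g)%:R <= B /\ forall x, `|(f x)%:R - g x| <= eps.

End Fourier.

(* Main.v *)
Require Import Defs.
From HB Require Import structures.
From mathcomp Require Import all_boot all_order all_algebra.
From mathcomp Require Import spectral complex.
From mathcomp Require Import reals exp.
From mathcomp Require Import zify ring lra.

Set Implicit Arguments.
Unset Strict Implicit.
Unset Printing Implicit Defensive.

Import Order.TTheory GRing.Theory Num.Theory.
Local Open Scope ring_scope.

(* Work in the Heisenberg picture: call an operator on m = n + a qubits of degree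
   at most l if it is a sum of operators each acting on at most l qubits, and
   conjugate the projector on the output qubit through the circuit.  A layer of
   one-qubit unitaries preserves the degree, and CZ gates on at most b^2 qubits
   multiply it by at most b^2.  A CZ gate on a larger set S is replaced by
   1 - 2 p(number of ones in S), where p, built from a Chebyshev polynomial,
   approximates AND with degree about (|S| / b) log m; as the sets S are disjoint
   this adds only O((m / b) log m) to the degree.  Optimizing b turns a degree l
   into about m^(2/3) l^(1/3), hence m^(1 - 3^-d) log m after d layers.  Evaluated
   on the input state an operator of degree l gives a sum of l-juntas of x.  For
   the ancilla bound, amplifying the error to 1/3 with a fixed polynomial gives
   n = O((n + a)^(1 - 3^-d) log (n + a)). *)

(** * Binary digits *)

Lemma bitn0 (b : bool) (y : nat) : bitn (b + 2 * y) 0 = b.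
Proof. by rewrite /bitn expn0 divn1 oddD oddM addbF oddb. Qed.

Lemma bitnS (b : bool) (y j : nat) : bitn (b + 2 * y) j.+1 = bitn y j.
Proof.
rewrite /bitn expnS divnMA; congr (odd (_ %/ _)).
by rewrite addnC mulnC divnMDl // divn_small ?addn0 //; case: b.
Qed.

Lemma bitn_ext (m i k : nat) : (i < 2 ^ m)%N -> (k < 2 ^ m)%N ->
  (forall j, (j < m)%N -> bitn i j = bitn k j) -> i = k.
Proof.
elim: m i k => [|m IH] i k; first by rewrite expn0 !ltnS !leqn0 => /eqP-> /eqP->.
rewrite expnS => li lk h.
have e x : x = (odd x + 2 * x./2)%N by rewrite mul2n odd_double_half.
have h0 := h 0 isT; rewrite (e i) (e k) !bitn0 in h0.
rewrite (e i) (e k) h0; congr (_ + 2 * _)%N; apply: IH; [lia|lia|].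
by move=> j jm; have := h j.+1 jm; rewrite {1}(e i) {1}(e k) !bitnS.
Qed.

(** The digits come from a function on [nat] rather than on ordinals, so that the induction can drop
    the lowest one by passing to [fun i => f i.+1]. *)
Lemma bitn_sum (n : nat) (f : nat -> bool) (k j : nat) :
  bitn (\sum_(i < n) f i * 2 ^ i + 2 ^ n * k) j =
  if (j < n)%N then f j else bitn k (j - n).
Proof.
elim: n f j => [|n IH] f j; first by rewrite big_ord0 add0n expn0 mul1n subn0.
rewrite big_ord_recl expn0 muln1.
have -> : (f 0 + \sum_(i < n) f (lift ord0 i) * 2 ^ lift ord0 i + 2 ^ n.+1 * k =
  f 0 + 2 * (\sum_(i < n) f i.+1 * 2 ^ i + 2 ^ n * k))%N.
  rewrite expnS mulnDr addnA mulnA; congr (_ + _ + _)%N.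
  by rewrite big_distrr; apply: eq_bigr => i _; rewrite /= /bump /= add1n expnS; lia.
case: j => [|j]; first by rewrite bitn0.
by rewrite bitnS (IH (fun i => f i.+1)) ltnS subSS.
Qed.

Lemma bits_numE (n : nat) (x : bits n) :
  bits_num x = (\sum_(i < n) oapp x false (insub (i : nat)) * 2 ^ i)%N.
Proof. by apply: eq_bigr => i _; rewrite valK. Qed.

Lemma bitn_bits_num (n : nat) (x : bits n) (k : nat) (j : 'I_n) :
  bitn (bits_num x + 2 ^ n * k) j = x j.
Proof.
by rewrite bits_numE (bitn_sum n (fun i => oapp x false (insub i))) ltn_ord valK.
Qed.

Lemma bitn_bits_num_high (n : nat) (x : bits n) (k j : nat) : (n <= j)%N ->
  bitn (bits_num x + 2 ^ n * k) j = bitn k (j - n).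
Proof.
by move=> nj; rewrite bits_numE (bitn_sum n (fun i => oapp x false (insub i))) ltnNge nj.
Qed.

(** Reindexing along this bijection turns a sum over basis indices into a sum over functions, the
    form in which a product of sums expands. *)
Definition dec (m : nat) (i : 'I_(2 ^ m)) : {ffun 'I_m -> 'I_2} :=
  [ffun j : 'I_m => b2I (bitn i j)].

Lemma b2I_inj : injective b2I.
Proof. by move=> [] [] // /(congr1 val); rewrite /= !inordK. Qed.

Lemma dec_bij (m : nat) : bijective (@dec m).
Proof.
apply: inj_card_bij => [i k /ffunP h|]; last by rewrite card_ffun !card_ord.
apply/val_inj/(@bitn_ext m); [exact: ltn_ord|exact: ltn_ord|] => j jm; have := h (Ordinal jm).
by rewrite !ffunE => /b2I_inj.
Qed.

Lemma bits_num_lt (n : nat) (x : bits n) : (bits_num x < 2 ^ n)%N.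
Proof.
have -> : (2 ^ n = (\sum_(j < n) 2 ^ j).+1)%N.
  elim: n {x} => [|n IH]; first by rewrite big_ord0.
  by rewrite big_ord_recr /= -addSn -IH expnS mul2n addnn.
by rewrite ltnS; apply: leq_sum => j _; case: (x j); rewrite ?mul1n ?mul0n.
Qed.

(** * Tensor layers and locality *)

Section Layers.
Variables (R : realType) (m : nat).
Local Notation C := R[i].
Local Notation N := (2 ^ m)%N.

Lemma eq_layer1 (u v : 'I_m -> 'M[C]_2) : u =1 v -> layer1 u = layer1 v.
Proof.
by move=> uv; apply/matrixP => i k; rewrite !mxE; apply: eq_bigr => j _; rewrite uv.
Qed.

Lemma layer1M (u v : 'I_m -> 'M[C]_2) :
  layer1 u *m layer1 v = layer1 (fun j => u j *m v j).
Proof.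
apply/matrixP => i k; rewrite !mxE.
under [RHS]eq_bigr do rewrite mxE.
rewrite bigA_distr_bigA (reindex (@dec m)); last exact: onW_bij (dec_bij m).
apply: eq_bigr => l _; rewrite !mxE -big_split.
by apply: eq_bigr => j _; rewrite ffunE.
Qed.

Lemma diag_mx_neq0 p (d : 'rV[C]_p) a b : diag_mx d a b != 0 -> a = b.
Proof. by rewrite mxE; case: (a =P b) => // _; rewrite eqxx. Qed.

Lemma scalar_mx_neq0 p (c : C) (a b : 'I_p) : (c%:M : 'M_p) a b != 0 -> a = b.
Proof. by rewrite mxE; case: (a =P b) => // _; rewrite eqxx. Qed.

Lemma layer1_1 : layer1 (fun _ : 'I_m => 1%:M : 'M[C]_2) = 1%:M.
Proof.
apply/matrixP => i k; rewrite !mxE; have [->|ik] := eqVneq i k.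
  by rewrite big1 // => j _; rewrite mxE eqxx.
have : dec i != dec k by apply: contra ik => /eqP/(bij_inj (dec_bij m)) ->.
apply: contraNeq; rewrite prodf_seq_neq0 => /allP h.
apply/eqP/ffunP => j; have := h j (mem_index_enum _).
by rewrite /= !ffunE => /scalar_mx_neq0.
Qed.

Lemma daggerE p q (A : 'M[C]_(p, q)) i j : dagger A i j = (A j i)^*.
Proof. by rewrite !mxE. Qed.

Lemma daggerM p q r (A : 'M[C]_(p, q)) (B : 'M[C]_(q, r)) :
  dagger (A *m B) = dagger B *m dagger A.
Proof. by rewrite /dagger trmx_mul map_mxM. Qed.

Lemma daggerK p q (A : 'M[C]_(p, q)) : dagger (dagger A) = A.
Proof. by apply/matrixP => i j; rewrite !daggerE conjCK. Qed.

Lemma dagger_layer1 (u : 'I_m -> 'M[C]_2) :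
  dagger (layer1 u) = layer1 (fun j => dagger (u j)).
Proof.
apply/matrixP => i k; rewrite daggerE !mxE rmorph_prod.
by apply: eq_bigr => j _; rewrite daggerE.
Qed.

Lemma unitary_mulr p (A : 'M[C]_p) : A \is unitarymx -> A *m dagger A = 1%:M.
Proof. by move/unitarymxP. Qed.

Lemma unitary_mull p (A : 'M[C]_p) : A \is unitarymx -> dagger A *m A = 1%:M.
Proof. by move/unitary_mulr/mulmx1C. Qed.

Lemma layer1_unitary (u : 'I_m -> 'M[C]_2) :
  (forall j, u j \is unitarymx) -> layer1 u \is unitarymx.
Proof.
move=> hu; apply/unitarymxP; rewrite -/(dagger _) dagger_layer1 layer1M -layer1_1.
by apply: eq_layer1 => j; rewrite unitary_mulr.
Qed.

Definition onqubit (j : 'I_m) (v : 'M[C]_2) : 'M[C]_N :=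
  layer1 (fun j' => if j' == j then v else 1%:M).

Lemma onqubit_neq0 j v i k : onqubit j v i k != 0 ->
  forall j' : 'I_m, j' != j -> bitn i j' = bitn k j'.
Proof.
rewrite mxE prodf_seq_neq0 => /allP h j' jj'.
have := h j' (mem_index_enum _); rewrite /= (negbTE jj').
by move/scalar_mx_neq0/b2I_inj.
Qed.

Lemma layer1_onqubit (j : 'I_m) (v : 'M[C]_2) (u : 'I_m -> 'M[C]_2) :
  u j \is unitarymx ->
  layer1 u *m onqubit j v = onqubit j (u j *m v *m dagger (u j)) *m layer1 u.
Proof.
move=> hu; rewrite !layer1M; apply: eq_layer1 => j'.
case: eqP => [->|_]; last by rewrite mulmx1 mul1mx.
by rewrite -mulmxA unitary_mull // mulmx1.
Qed.

(* The operator T acts as the identity outside the qubits of W; this is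
   phrased as membership in the commutant of the operators outside W, which makes
   the stability under products and conjugation immediate. *)
Definition local (W : {set 'I_m}) (T : 'M[C]_N) : Prop :=
  forall j, j \notin W -> forall v, T *m onqubit j v = onqubit j v *m T.

Lemma local_sub (W V : {set 'I_m}) T : W \subset V -> local W T -> local V T.
Proof. by move=> /subsetP WV h j jV; apply: h; apply: contra jV; apply: WV. Qed.

Lemma local_mul W T T' : local W T -> local W T' -> local W (T *m T').
Proof. by move=> h h' j jW v; rewrite -mulmxA h' // mulmxA h // mulmxA. Qed.

Lemma local_setT T : local setT T.
Proof. by move=> j; rewrite inE. Qed.

(** Moving the layer past a one-qubit operator [v] on qubit [j] only replaces [v] by its conjugate
    under [u j], still on qubit [j]; since [T] commutes with all such operators, so does its
    conjugate. *)
Lemma local_conj_layer1 W T (u : 'I_m -> 'M[C]_2) :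
  (forall j, u j \is unitarymx) -> local W T ->
  local W (dagger (layer1 u) *m T *m layer1 u).
Proof.
move=> hu hT j jW v; have U := layer1_unitary hu.
have F := layer1_onqubit v (hu j); set w := onqubit j (_ *m _ *m _) in F.
have F' : onqubit j v *m dagger (layer1 u) = dagger (layer1 u) *m w.
  rewrite -[LHS]mul1mx -(unitary_mull U) -mulmxA (mulmxA (layer1 u)) F.
  by rewrite -(mulmxA w) unitary_mulr // mulmx1.
by rewrite -mulmxA F mulmxA -(mulmxA _ T) hT // !mulmxA F'.
Qed.

Definition diagf (h : 'I_N -> C) : 'M[C]_N := diag_mx (\row_(i < N) h i).

Lemma diagfE h i k : diagf h i k = h i *+ (i == k).
Proof. by rewrite !mxE. Qed.

Lemma mul_diagf p h (A : 'M[C]_(N, p)) i k : (diagf h *m A) i k = h i * A i k.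
Proof. by rewrite mul_diag_mx !mxE. Qed.

Lemma mul_mx_diagf p h (A : 'M[C]_(p, N)) i k : (A *m diagf h) i k = A i k * h k.
Proof. by rewrite mul_mx_diag !mxE. Qed.

Lemma diagfM h g : diagf h *m diagf g = diagf (fun i => h i * g i).
Proof. by apply/matrixP => i k; rewrite mul_diagf !diagfE mulrnAr. Qed.

Lemma eq_diagf h g : h =1 g -> diagf h = diagf g.
Proof. by move=> hg; apply/matrixP => i k; rewrite !diagfE hg. Qed.

Definition depends (W : {set 'I_m}) (h : 'I_N -> C) : Prop :=
  forall i k : 'I_N, (forall j, j \in W -> bitn i j = bitn k j) -> h i = h k.

Lemma local_diagf W h : depends W h -> local W (diagf h).
Proof.
move=> hW j jW v; apply/matrixP => i k; rewrite mul_diagf mul_mx_diagf mulrC.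
have [->|E] := eqVneq (onqubit j v i k) 0; first by rewrite !mul0r.
congr (_ * _); apply: hW => j' j'W; apply: (onqubit_neq0 E).
by apply: contra jW => /eqP <-.
Qed.

Lemma onqubit_diag (j : 'I_m) (g : 'I_2 -> C) :
  onqubit j (diag_mx (\row_b g b)) = diagf (fun i => g (b2I (bitn i j))).
Proof.
apply/matrixP => i k; rewrite diagfE mxE; have [->|ik] := eqVneq i k.
  rewrite (bigD1 j) //= eqxx big1 ?mulr1 ?mxE ?eqxx // ?mxE // => j' /negbTE ->.
  by rewrite mxE eqxx.
have : dec i != dec k by apply: contra ik => /eqP/(bij_inj (dec_bij m)) ->.
apply: contraNeq; rewrite prodf_seq_neq0 => /allP h.
apply/eqP/ffunP => j'; have := h j' (mem_index_enum _).
by rewrite /= !ffunE; case: ifP => _; [move/diag_mx_neq0|move/scalar_mx_neq0].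
Qed.

Lemma local_eq0 W T (i k : 'I_N) j : local W T -> j \notin W -> bitn i j != bitn k j ->
  T i k = 0.
Proof.
move=> hT jW ik.
(* Commutation is tested on the projector onto the value of qubit [j] in [i]: at entry (i, k) one
   side is [T i k] and the other is 0. *)
have := hT j jW (diag_mx (\row_b (b == b2I (bitn i j))%:R)).
rewrite onqubit_diag => /matrixP/(_ i k).
rewrite mul_diagf mul_mx_diagf eqxx mul1r (inj_eq b2I_inj).
by rewrite eq_sym (negbTE ik) mulr0 => <-.
Qed.

(** A nonzero entry of [T] joins two indices that agree outside [W], and [h] takes the same value at
    both. *)
Lemma local_diagf_comm W h T :
  local W T -> depends (~: W) h -> diagf h *m T = T *m diagf h.
Proof.
move=> hT hh; apply/matrixP => i k; rewrite mul_diagf mul_mx_diagf mulrC.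
have [->|E] := eqVneq (T i k) 0; first by rewrite !mul0r.
congr (_ * _); apply: hh => j; rewrite inE => jW.
by apply/eqP; apply: contraNT E => /(local_eq0 hT jW) ->.
Qed.

Lemma dagger_diagf h : (forall i, h i \is Num.real) -> dagger (diagf h) = diagf h.
Proof.
move=> hr; apply/matrixP => i k; rewrite daggerE !diagfE eq_sym.
by case: eqP => [->|_]; rewrite ?mulr0n ?rmorph0 // mulr1n; apply/CrealP.
Qed.

(** Summands are added one at a time, so that closure properties follow by induction on the
    decomposition. *)
Inductive deg_le (l : nat) : 'M[C]_N -> Prop :=
  | deg_le0 : deg_le l 0
  | deg_leD (W : {set 'I_m}) T A : (#|W| <= l)%N -> local W T -> deg_le l A -> deg_le l (T + A).

Lemma local_deg l (W : {set 'I_m}) T : (#|W| <= l)%N -> local W T -> deg_le l T.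
Proof. by move=> Wl hT; rewrite -[T]addr0; apply: (deg_leD Wl hT (deg_le0 l)). Qed.

Lemma deg_le_add l A B : deg_le l A -> deg_le l B -> deg_le l (A + B).
Proof.
elim=> [|W T A' Wl hT _ IH] hB; first by rewrite add0r.
by rewrite -addrA; apply: (deg_leD Wl hT); apply: IH.
Qed.

Lemma deg_le_sub l l' A : (l <= l')%N -> deg_le l A -> deg_le l' A.
Proof.
move=> ll; elim=> [|W T A' Wl hT _ IH]; first exact: deg_le0.
by apply: deg_leD hT IH; apply: leq_trans ll.
Qed.

Lemma deg_le_mul l l' A B : deg_le l A -> deg_le l' B -> deg_le (l + l') (A *m B).
Proof.
move=> hA; elim=> [|V S B' Vl hS _ IHB]; first by rewrite mulmx0; apply: deg_le0.
rewrite mulmxDr; apply: deg_le_add => //.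
elim: hA => [|W T A' Wl hT _ IHA]; first by rewrite mul0mx; apply: deg_le0.
rewrite mulmxDl; apply: (@deg_leD _ (W :|: V)) => //.
  by rewrite (leq_trans (leq_card_setU _ _)) ?leq_add.
by apply: local_mul; [apply: local_sub hT|apply: local_sub hS];
  rewrite ?subsetUl ?subsetUr.
Qed.

Lemma deg_le_max A : deg_le m A.
Proof. by apply: (@local_deg _ setT) (@local_setT _); rewrite cardsT card_ord. Qed.

Lemma deg_le_conj (l l' : nat) (V V' : 'M[C]_N) (A : 'M[C]_N) :
  (forall (W : {set 'I_m}) T, (#|W| <= l)%N -> local W T -> deg_le l' (V *m T *m V')) ->
  deg_le l A -> deg_le l' (V *m A *m V').
Proof.
move=> h; elim=> [|W T B Wl hT _ IH]; first by rewrite mulmx0 mul0mx; apply: deg_le0.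
by rewrite mulmxDr mulmxDl; apply: deg_le_add IH; apply: h hT.
Qed.

Lemma deg_le_conj_layer1 l (u : 'I_m -> 'M[C]_2) A :
  (forall j, u j \is unitarymx) -> deg_le l A ->
  deg_le l (dagger (layer1 u) *m A *m layer1 u).
Proof.
move=> hu; apply: deg_le_conj => W T Wl hT.
by apply: (local_deg Wl); apply: local_conj_layer1.
Qed.

(** Functions of the basis index are identified with diagonal operators, so that their degree
    calculus is inherited from [deg_le]. *)
Definition fdeg_le (l : nat) (h : 'I_N -> C) : Prop := deg_le l (diagf h).

Lemma eq_fdeg_le l h g : h =1 g -> fdeg_le l h -> fdeg_le l g.
Proof. by move=> hg; rewrite /fdeg_le (eq_diagf hg). Qed.

Lemma fdeg_leM l l' h g : fdeg_le l h -> fdeg_le l' g ->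
  fdeg_le (l + l') (fun i => h i * g i).
Proof. by move=> hh hg; rewrite /fdeg_le -diagfM; apply: deg_le_mul. Qed.

Lemma fdeg_leD l h g : fdeg_le l h -> fdeg_le l g ->
  fdeg_le l (fun i => h i + g i).
Proof.
move=> hh hg; have := deg_le_add hh hg; congr deg_le.
by apply/matrixP => i k; rewrite mxE !diagfE mulrnDl.
Qed.

Lemma fdeg_le_depends l (W : {set 'I_m}) h : (#|W| <= l)%N -> depends W h -> fdeg_le l h.
Proof. by move=> Wl /local_diagf; apply: local_deg. Qed.

Lemma fdeg_le_cst l c : fdeg_le l (fun=> c).
Proof. by apply: (@fdeg_le_depends _ set0); rewrite ?cards0. Qed.

Lemma fdeg_le_prod (I : eqType) (r : seq I) (P : pred I) (e : I -> nat)
    (h : I -> 'I_N -> C) :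
  (forall S, P S -> fdeg_le (e S) (h S)) ->
  fdeg_le (\sum_(S <- r | P S) e S) (fun i => \prod_(S <- r | P S) h S i).
Proof.
move=> he; elim: r => [|S r IH].
  by apply: (@eq_fdeg_le _ (fun=> 1)) (fdeg_le_cst _ _) => i; rewrite big_nil.
rewrite big_cons; case: ifP => PS; last first.
  by apply: eq_fdeg_le IH => i; rewrite big_cons PS.
by apply: eq_fdeg_le (fdeg_leM (he S PS) IH) => i; rewrite big_cons PS.
Qed.

Lemma fdeg_le_sum (l : nat) (I : Type) (r : seq I) (P : pred I) (h : I -> 'I_N -> C) :
  (forall S, P S -> fdeg_le l (h S)) ->
  fdeg_le l (fun i => \sum_(S <- r | P S) h S i).
Proof.
move=> he; elim: r => [|S r IH].
  by apply: (@eq_fdeg_le _ (fun=> 0)) (fdeg_le_cst _ _) => i; rewrite big_nil.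
case PS: (P S); last by apply: eq_fdeg_le IH => i; rewrite big_cons PS.
by apply: eq_fdeg_le (fdeg_leD (he S PS) IH) => i; rewrite big_cons PS.
Qed.

Lemma fdeg_leX l h k : fdeg_le l h -> fdeg_le (l * k) (fun i => h i ^+ k).
Proof.
move=> hh; elim: k => [|k IH]; first exact: fdeg_le_cst.
by rewrite mulnS; apply: eq_fdeg_le (fdeg_leM hh IH) => i; rewrite exprS.
Qed.

Lemma fdeg_le_horner l h (p : {poly C}) : fdeg_le l h ->
  fdeg_le (l * (size p).-1) (fun i => p.[h i]).
Proof.
move=> hh.
apply: (@eq_fdeg_le _ (fun i => \sum_(k < size p) p`_k * h i ^+ k)).
  by move=> i; rewrite horner_coef.
apply: fdeg_le_sum => k _; rewrite -[(l * _)%N]add0n; apply: fdeg_leM.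
  exact: fdeg_le_cst.
apply: deg_le_sub (fdeg_leX _ hh).
by rewrite leq_mul2l -ltnS (leq_trans (ltn_ord k)) ?leqSpred ?orbT.
Qed.

(** The count is a sum of one-qubit functions whatever the size of [S]; hence a polynomial of degree
    r in it has operator degree at most r. *)
Lemma fdeg_le_count (S : {set 'I_m}) :
  fdeg_le 1 (fun i => #|[set j in S | bitn i j]|%:R).
Proof.
apply: (@eq_fdeg_le _ (fun i => \sum_(j in S) (bitn i j : nat)%:R)).
  move=> i; rewrite -natr_sum; congr (_%:R).
  rewrite -sum1_card big_mkcond [in RHS]big_mkcond; apply: eq_bigr => j _.
  by rewrite inE; case: (j \in S); case: bitn.
apply: fdeg_le_sum => j _; apply: (@fdeg_le_depends _ [set j]); rewrite ?cards1 //.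
by move=> i k /(_ j); rewrite set11 => ->.
Qed.
End Layers.

(** * Chebyshev approximation of AND *)

Section Chebyshev.
Variable R : realFieldType.

(* Chebyshev polynomials of both kinds: the pair (T_r, U_(r-1)), with U_(-1) = 0. *)
Fixpoint cheb (r : nat) : {poly R} * {poly R} :=
  if r is r'.+1 then
    let: (t, u) := cheb r' in ('X * t - (1 - 'X ^+ 2) * u, 'X * u + t)
  else (1, 0).

Lemma size_cheb r : (size (cheb r).1 <= r.+1)%N /\ (size (cheb r).2 <= r)%N.
Proof.
elim: r => [|r]; first by rewrite /= size_poly1 size_poly0.
rewrite /=; case: (cheb r) => t u /= [ht hu].
have hX (p : {poly R}) : (size ('X * p)%R <= (size p).+1)%N.
  by rewrite mulrC; have [->|p0] := eqVneq p 0; rewrite ?mul0r ?size_poly0 // size_mulX.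
have hT : (size ('X * t)%R <= r.+2)%N by apply: leq_trans (hX _) _.
have hU : (size ('X * u)%R <= r.+1)%N by apply: leq_trans (hX _) _.
split; apply: leq_trans (size_polyD _ _) _; rewrite geq_max; apply/andP; split => //.
rewrite size_polyN mulrBl mul1r; apply: leq_trans (size_polyD _ _) _; rewrite geq_max.
apply/andP; split; first by apply: leq_trans hu _; rewrite leqW.
rewrite size_polyN expr2 -mulrA; apply: leq_trans (hX _) _.
by rewrite ltnS; apply: leq_trans (hX _) _; rewrite ltnS.
Qed.

Lemma horner_chebS r (x : R) :
  (cheb r.+1).1.[x] = x * (cheb r).1.[x] - (1 - x ^+ 2) * (cheb r).2.[x] /\
  (cheb r.+1).2.[x] = x * (cheb r).2.[x] + (cheb r).1.[x].
Proof. by rewrite /=; case: (cheb r) => t u /=; rewrite !hornerE. Qed.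

(** With x = cos t this is cos^2(rt) + sin^2(rt) = 1; in polynomial form it bounds T_r on [0, 1]
    without trigonometry. *)
Lemma cheb_pell r (x : R) :
  (cheb r).1.[x] ^+ 2 + (1 - x ^+ 2) * (cheb r).2.[x] ^+ 2 = 1.
Proof.
elim: r => [|r IH]; first by rewrite /= hornerC horner0; lra.
by have [-> ->] := horner_chebS r x; rewrite -[RHS]IH; ring.
Qed.

Lemma cheb_le1 r (x : R) : 0 <= x <= 1 -> (cheb r).1.[x] ^+ 2 <= 1.
Proof.
move=> /andP[x0 x1]; rewrite -(cheb_pell r x) lerDl mulr_ge0 ?sqr_ge0 //.
by rewrite subr_ge0 expr_le1.
Qed.

(** The increments obey the recurrence [E] and grow by at least 2 mu at each step, because T_(r+1)
    >= 1; adding up the odd numbers gives r^2. Both bounds are proved together since each feeds the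
    other. *)
Lemma cheb_grow r (mu : R) : 0 <= mu ->
  1 + mu * (r ^ 2)%:R <= (cheb r).1.[1 + mu] /\
  mu * (2 * r + 1)%:R <= (cheb r.+1).1.[1 + mu] - (cheb r).1.[1 + mu].
Proof.
move=> mu0; elim: r => [|r [IH1 IH2]].
  by rewrite /= !hornerE; split; lra.
have E : (cheb r.+2).1.[1 + mu] - (cheb r.+1).1.[1 + mu] =
  (cheb r.+1).1.[1 + mu] - (cheb r).1.[1 + mu] + 2 * mu * (cheb r.+1).1.[1 + mu].
  have [-> _] := horner_chebS r.+1 (1 + mu).
  by have [-> ->] := horner_chebS r (1 + mu); ring.
have h : 1 + mu * (r.+1 ^ 2)%:R <= (cheb r.+1).1.[1 + mu].
  have -> : (r.+1 ^ 2 = r ^ 2 + (2 * r + 1))%N by rewrite -addn1 sqrnD muln1 exp1n -addnA (addnC 1).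
  by rewrite natrD mulrDr addrA (le_trans (lerD IH1 IH2)) // addrC subrK.
split=> //; rewrite E.
have -> : (2 * r.+1 + 1 = 2 * r + 1 + 2)%N by lia.
rewrite natrD mulrDr lerD // (mulrC mu) -mulrA ler_wpM2l // ler_peMr //.
by apply: le_trans h; rewrite lerDl mulr_ge0.
Qed.

(** The affine change sends k to (k + 1) / s, so that among 0, ..., s only the full count s leaves
    [0, 1]; the scaling makes the value there 1. *)
Definition and_base (s r : nat) : {poly R} :=
  ((cheb r).1.[1 + s%:R^-1])^-1 *: ((cheb r).1 \Po (s%:R^-1 *: ('X + 1))).

(* The points (k + 1) / s with k < s lie in [0, 1], where |T_r| <= 1, whereas
   T_r(1 + 1 / s) >= 1 + r^2 / s >= 2 as soon as r^2 >= s. *)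
Definition and_poly (s r tau : nat) : {poly R} := and_base s r ^+ (2 * tau).

Lemma size_and_poly s r tau : ((size (and_poly s r tau)).-1 <= r * (2 * tau))%N.
Proof.
apply: (@leq_trans ((size (and_base s r)).-1 * (2 * tau))).
  by rewrite -subn1 leq_subLR add1n size_poly_exp_leq.
rewrite leq_mul2r; apply/orP; right.
apply: (@leq_trans (size ((cheb r).1 \Po (s%:R^-1 *: ('X + 1)))).-1).
  by rewrite -!subn1 leq_sub2r // size_scale_leq.
have h3 := size_comp_poly_leq (cheb r).1 (s%:R^-1 *: ('X + 1)).
have [h _] := size_cheb r.
have h2 : (size (s%:R^-1 *: ('X + 1) : {poly R}) <= 2)%N.
  by rewrite (leq_trans (size_scale_leq _ _)) // -[1]opprK -polyCN size_XsubC.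
rewrite -subn1 leq_subLR add1n; apply: leq_trans h3 _.
rewrite ltnS -[X in (_ <= X)%N]muln1; apply: leq_mul; rewrite -subn1 leq_subLR add1n //.
Qed.

Lemma horner_and_base s r (x : R) : (and_base s r).[x] =
  (cheb r).1.[s%:R^-1 * (x + 1)] / (cheb r).1.[1 + s%:R^-1].
Proof. by rewrite /and_base hornerZ horner_comp !hornerE mulrC. Qed.

Lemma and_polyE1 s r tau : (0 < s)%N -> (and_poly s r tau).[s%:R] = 1.
Proof.
move=> s0; rewrite horner_exp horner_and_base mulrDr mulr1 mulVf ?pnatr_eq0 -?lt0n //.
have mu0 : 0 <= s%:R^-1 :> R by rewrite invr_ge0.
have [h _] := cheb_grow r mu0.
rewrite divff ?expr1n //; apply: lt0r_neq0; apply: lt_le_trans h.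
by rewrite ltr_pwDl // mulr_ge0 // invr_ge0.
Qed.

(** The exponent is even. Nonnegativity gives 1 - 2 p <= 1, one half of the fact that approximate
    gates have norm at most 1. *)
Lemma and_poly_ge0 s r tau x : 0 <= (and_poly s r tau).[x].
Proof. by rewrite horner_exp mulnC exprM sqr_ge0. Qed.

Lemma and_poly_small s r tau k : (s <= r ^ 2)%N -> (k < s)%N ->
  (and_poly s r tau).[k%:R] <= (4 ^ tau)%:R^-1.
Proof.
move=> sr ks; rewrite horner_exp horner_and_base exprM natrX -exprVn.
have s0 : (0 : R) < s%:R by rewrite ltr0n (leq_ltn_trans _ ks).
apply: lerXn2r; rewrite ?nnegrE ?sqr_ge0 ?invr_ge0 //.
have mu0 : 0 <= s%:R^-1 :> R by rewrite invr_ge0.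
have [h _] := cheb_grow r mu0.
have h2 : 2 <= (cheb r).1.[1 + s%:R^-1].
  apply: le_trans h; suff : 1 <= s%:R^-1 * (r ^ 2)%:R :> R by lra.
  by rewrite mulrC ler_pdivlMr // mul1r ler_nat.
rewrite expr_div_n ler_pdivrMr ?exprn_gt0 //; last lra.
apply: (@le_trans _ _ 1).
  apply: cheb_le1; rewrite mulr_ge0 ?addr_ge0 //= mulrC.
  by rewrite ler_pdivrMr // mul1r natr1 ler_nat.
by rewrite expr2; nra.
Qed.
End Chebyshev.

(** * Approximate CZ layers *)

Section Gates.
Variables (R : realType) (m : nat).
Local Notation C := R[i].
Local Notation N := (2 ^ m)%N.
Implicit Types (S V W : {set 'I_m}) (P : {set {set 'I_m}}).

Definition czgate S (i : 'I_N) : C := if [forall j in S, bitn i j] then -1 else 1.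

Definition ones S (i : 'I_N) : nat := #|[set j in S | bitn i j]|.

(* For #|S| > b^2 the degree r = #|S| %/ b + 1 satisfies r^2 >= #|S|, as needed
   for the approximation, while b * r <= 2 * #|S| controls the total degree. *)
Definition approx_gate (b tau : nat) S (i : 'I_N) : C :=
  if (#|S| <= b ^ 2)%N then czgate S i
  else (1 - 2 * (and_poly R #|S| (#|S| %/ b).+1 tau).[(ones S i)%:R])%:C%C.

Definition approx_cz (b tau : nat) P : 'M[C]_N :=
  diagf (fun i => \prod_(S in P) approx_gate b tau S i).

Lemma czlayerE P : czlayer R P = diagf (fun i => \prod_(S in P) czgate S i).
Proof. by []. Qed.

Lemma ones_le S i : (ones S i <= #|S|)%N.
Proof. by apply: subset_leq_card; apply/subsetP => j; rewrite inE => /andP[]. Qed.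

Lemma ones_full S i : (ones S i == #|S|) = [forall j in S, bitn i j].
Proof.
have sub : [set j in S | bitn i j] \subset S.
  by apply/subsetP => j; rewrite inE => /andP[].
rewrite (subset_leqif_cards sub); apply/eqP/forall_inP => [E j jS|h].
  by move: jS; rewrite -{1}E inE => /andP[].
by apply/setP => j; rewrite inE; case: (boolP (j \in S)) => //= /h.
Qed.

Lemma czgate_depends S : depends S (czgate S).
Proof.
move=> i k h; rewrite /czgate; congr (if _ then _ else _).
by apply: eq_forallb => j; case: (boolP (j \in S)) => //= /h ->.
Qed.

Lemma czgate_sqr S i : czgate S i * czgate S i = 1.
Proof. by rewrite /czgate; case: ifP; rewrite ?mulrNN mulr1. Qed.

Lemma depends_prod (I : Type) (r : seq I) (Q : pred I) (h : I -> 'I_N -> C) W :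
  (forall x, Q x -> depends W (h x)) -> depends W (fun i => \prod_(x <- r | Q x) h x i).
Proof. by move=> hQ i k ik; apply: eq_bigr => x /hQ /(_ i k ik). Qed.

Lemma depends_sub W V (h : 'I_N -> C) : W \subset V -> depends W h -> depends V h.
Proof. by move=> /subsetP WV hW i k ik; apply: hW => j /WV /ik. Qed.

(** The light cone of [W] through the gates on at most b^2 qubits. For disjoint blocks a qubit lies
    in at most one of them, so [pblock] finds the only relevant gate. *)
Definition spread (b : nat) P W : {set 'I_m} :=
  \bigcup_(w in W) (if (w \in cover P) && (#|pblock P w| <= b ^ 2)%N
                    then pblock P w else [set w]).

Lemma card_spread b P W : (0 < b)%N -> (#|spread b P W| <= #|W| * b ^ 2)%N.
Proof.
move=> b0; rewrite -sum_nat_const /spread.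
elim/big_rec2: _ => [|w n V _ IH]; first by rewrite cards0.
rewrite (leq_trans (leq_card_setU _ _)) // leq_add //.
by case: ifP => [/andP[]//|_]; rewrite cards1 expn_gt0 b0.
Qed.

Lemma sub_spread b P W : W \subset spread b P W.
Proof.
apply/subsetP => w wW; apply/bigcupP; exists w => //.
by case: ifP => [/andP[wP _]|_]; rewrite ?mem_pblock // set11.
Qed.

Lemma block_sub_spread b P W S : trivIset P -> S \in P -> (#|S| <= b ^ 2)%N ->
  ~~ [disjoint S & W] -> S \subset spread b P W.
Proof.
move=> tP SP Sb /pred0Pn[w /andP[/= wS wW]].
apply/subsetP => j jS; apply/bigcupP; exists w => //.
have -> : w \in cover P by apply/bigcupP; exists S.
by rewrite (def_pblock tP SP wS) Sb.
Qed.

(** The gates that miss [W] (product [D2]) commute with [T] and square to 1, so they cancel; those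
    that meet [W] (product [D1]) act inside its light cone. *)
Lemma local_conj_small b P W T : trivIset P -> local W T ->
  let D := diagf (fun i => \prod_(S in P | (#|S| <= b ^ 2)%N) czgate S i) in
  local (spread b P W) (D *m T *m D).
Proof.
move=> tP hT D.
pose D1 := fun i => \prod_(S in P | (#|S| <= b ^ 2)%N && ~~ [disjoint S & W]) czgate S i.
pose D2 := fun i => \prod_(S in P | (#|S| <= b ^ 2)%N && [disjoint S & W]) czgate S i.
have DE : D = diagf D1 *m diagf D2.
  rewrite diagfM; apply: eq_diagf => i; rewrite mulrC (bigID (fun S => [disjoint S & W])) /=.
  by congr (_ * _); apply: eq_bigl => S; rewrite andbA.
have D12 : diagf D1 *m diagf D2 = diagf D2 *m diagf D1.
  by rewrite !diagfM; apply: eq_diagf => i; rewrite mulrC.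
have D22 : diagf D2 *m diagf D2 = 1%:M.
  rewrite diagfM; apply/matrixP => i k; rewrite diagfE mxE -big_split /=.
  by rewrite big1 // => S _; rewrite czgate_sqr.
have T2 : diagf D2 *m T = T *m diagf D2.
  apply: (local_diagf_comm hT); apply: depends_prod => S /andP[_ /andP[_ dS]].
  by apply: depends_sub (@czgate_depends S); rewrite -disjoints_subset.
have -> : D *m T *m D = diagf D1 *m T *m diagf D1.
  rewrite DE {2}D12 -!mulmxA (mulmxA (diagf D2) T) T2 -(mulmxA T) (mulmxA (diagf D2)).
  by rewrite D22 mul1mx.
have l1 : local (spread b P W) (diagf D1).
  apply: local_diagf; apply: depends_prod => S /andP[SP /andP[Sb dS]].
  by apply: depends_sub (@czgate_depends S); apply: block_sub_spread.
by apply: local_mul => //; apply: local_mul => //; apply: local_sub hT; apply: sub_spread.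
Qed.

Definition large_cost (b tau : nat) P : nat :=
  \sum_(S in P | ~~ (#|S| <= b ^ 2)%N) (#|S| %/ b).+1 * (2 * tau).

(** The sets of [P] are disjoint, so their sizes add up to at most [m]. *)
Lemma large_cost_le b tau P : (0 < b)%N -> trivIset P ->
  (b * large_cost b tau P <= 4 * tau * m)%N.
Proof.
move=> b0 tP; rewrite /large_cost big_distrr /=.
apply: (@leq_trans (\sum_(S in P) 4 * tau * #|S|)); last first.
  rewrite -big_distrr /= leq_mul2l; apply/orP; right.
  by move/eqP: tP => ->; rewrite -[X in (_ <= X)%N](card_ord m) max_card.
rewrite big_mkcondr /=; apply: leq_sum => S _; case: ifP => // Sb.
have h1 : (b * (#|S| %/ b) <= #|S|)%N by rewrite mulnC leq_divM.
(* This absorbs the extra [b] caused by rounding [#|S| %/ b] up. *)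
have h2 : (b <= #|S|)%N.
  move: Sb; rewrite -ltnNge => /ltnW; apply: leq_trans.
  by rewrite -[X in (X <= _)%N]expn1 leq_pexp2l.
have h3 : (b * (#|S| %/ b).+1 <= 2 * #|S|)%N by rewrite mulnS mul2n -addnn leq_add.
rewrite mulnA (_ : 4 * tau * #|S| = 2 * #|S| * (2 * tau))%N ?leq_mul2r ?h3 ?orbT //.
by rewrite (mulnACA 2 _ 2) -mulnA (mulnC tau).
Qed.

(** All gates are diagonal and commute. The exact ones ([D]) conjugate and only enlarge supports;
    the approximated ones ([H]) need not be unitary, so nothing cancels and their degree is paid
    once on each side. *)
Lemma approx_cz_deg b tau P l A : (0 < b)%N -> trivIset P -> deg_le l A ->
  deg_le (l * b ^ 2 + 2 * large_cost b tau P) (approx_cz b tau P *m A *m approx_cz b tau P).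
Proof.
move=> b0 tP hA.
pose D := diagf (fun i => \prod_(S in P | (#|S| <= b ^ 2)%N) czgate S i).
pose H := diagf (fun i => \prod_(S in P | ~~ (#|S| <= b ^ 2)%N) approx_gate b tau S i).
have E1 : approx_cz b tau P = D *m H.
  rewrite diagfM; apply: eq_diagf => i; rewrite (bigID (fun S => #|S| <= b ^ 2)%N) /=.
  by congr (_ * _); apply: eq_bigr => S /andP[_ h]; rewrite /approx_gate h.
have E2 : D *m H = H *m D.
  by rewrite !diagfM; apply: eq_diagf => i; rewrite mulrC.
have hH : deg_le (large_cost b tau P) H.
  apply: fdeg_le_prod => S /andP[_ /negbTE Sb].
  rewrite mulnC; set p := and_poly R #|S| (#|S| %/ b).+1 tau.
  apply: (@eq_fdeg_le _ _ _ (fun i => (1 - 2 * (map_poly (real_complex R) p).[(ones S i)%:R]))).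
    move=> i; rewrite /approx_gate Sb -/p.
    rewrite -(rmorph_nat (real_complex R) (ones S i)) horner_map rmorphB rmorphM rmorph1.
    by rewrite rmorph_nat.
  rewrite -[(2 * tau * _)%N]add0n; apply: fdeg_leD; first exact: fdeg_le_cst.
  apply: (@eq_fdeg_le _ _ _ (fun i => (-2) * (map_poly (real_complex R) p).[(ones S i)%:R])).
    by move=> i; rewrite mulNr.
  apply: fdeg_leM; first exact: fdeg_le_cst.
  apply: deg_le_sub (fdeg_le_horner _ (fdeg_le_count _ S)).
  by rewrite mul1n size_map_poly mulnC size_and_poly.
have -> : approx_cz b tau P *m A *m approx_cz b tau P = H *m (D *m A *m D) *m H.
  by rewrite {1}E1 E2 E1 !mulmxA.
rewrite mul2n -addnn addnCA addnA.
apply: deg_le_mul (hH); apply: (deg_le_mul hH).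
apply: deg_le_conj hA => W T Wl hT.
apply: (@local_deg _ _ _ (spread b P W)); last exact: local_conj_small.
by rewrite (leq_trans (card_spread _ _ b0)) // leq_mul2r Wl orbT.
Qed.

End Gates.

(** * Error propagation *)

Section Contractions.
Variables (R : realType) (m : nat).
Local Notation C := R[i].
Local Notation N := (2 ^ m)%N.

(** The square of the Frobenius norm: applied to a projected state it is directly an outcome
    probability. *)
Definition frob p q (A : 'M[C]_(p, q)) : C := \sum_i \sum_j `|A i j| ^+ 2.

Lemma frob_ge0 p q (A : 'M[C]_(p, q)) : 0 <= frob A.
Proof. by apply: sumr_ge0 => i _; apply: sumr_ge0 => j _; rewrite exprn_ge0. Qed.

Lemma frobE p q (A : 'M[C]_(p, q)) : frob A = \tr (dagger A *m A).
Proof.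
rewrite /frob exchange_big; apply: eq_bigr => j _; rewrite mxE.
by apply: eq_bigr => i _; rewrite daggerE normCKC.
Qed.

Lemma frob_unitary p q (U : 'M[C]_p) (A : 'M[C]_(p, q)) :
  U \is unitarymx -> frob (U *m A) = frob A.
Proof.
move=> hU; rewrite !frobE daggerM -mulmxA (mulmxA (dagger U)).
by rewrite unitary_mull // mul1mx.
Qed.

Lemma frob_diagf q h (c : C) (A : 'M[C]_(N, q)) :
  (forall i : 'I_N, `|h i| <= c) -> frob (diagf h *m A) <= c ^+ 2 * frob A.
Proof.
move=> hc; rewrite /frob mulr_sumr; apply: ler_sum => i _.
rewrite mulr_sumr; apply: ler_sum => j _; rewrite mul_diagf normrM exprMn.
have c0 : 0 <= c by apply: le_trans (hc i).
by rewrite ler_wpM2r ?exprn_ge0 // lerXn2r // nnegrE.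
Qed.

(* AM-GM on |x - y| and eta / 2 * |x + y|; it stands in for the triangle
   inequality of the Frobenius norm. *)
Lemma sqr_norm_diff (eta x y : C) : 0 <= eta ->
  eta * `| `|x| ^+ 2 - `|y| ^+ 2| <= `|x - y| ^+ 2 + (eta / 2) ^+ 2 * `|x + y| ^+ 2.
Proof.
move=> eta0.
have E : 2 * (`|x| ^+ 2 - `|y| ^+ 2) = (x - y) * (x + y)^* + (x - y)^* * (x + y).
  by rewrite !normCK !rmorphD !rmorphN /=; ring.
have h : 2 * `| `|x| ^+ 2 - `|y| ^+ 2| <= 2 * (`|x - y| * `|x + y|).
  rewrite -[X in X * _ <= _](ger0_norm (ler0n _ 2)) -normrM E.
  by rewrite (le_trans (ler_normD _ _)) // !normrM !norm_conjC mulr_natl mulr2n.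
rewrite ler_pM2l // in h; apply: le_trans (ler_wpM2l eta0 h) _.
rewrite -subr_ge0.
have -> : `|x - y| ^+ 2 + (eta / 2) ^+ 2 * `|x + y| ^+ 2 - eta * (`|x - y| * `|x + y|)
  = (`|x - y| - eta / 2 * `|x + y|) ^+ 2 by field.
apply: real_exprn_even_ge0 => //; apply: rpredB; first exact: normr_real.
by apply: rpredM; rewrite ?normr_real // ger0_real // divr_ge0 // ler0n.
Qed.

Definition contraction q p (V : 'M[C]_(p, N)) : Prop :=
  forall W : 'M[C]_(N, q), frob (V *m W) <= frob W.

(** Sum [sqr_norm_diff] over the entries of [X] and [Y]. Here X - Y contributes at most eta^2 and X
    + Y at most (eta / 2)^2 * 4, both times [frob W]; dividing by [eta] leaves the factor 2 eta. *)
Lemma contraction_diff q p (V : 'M[C]_(p, N)) g h (eta : C) (W : 'M[C]_(N, q)) :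
  0 < eta -> contraction q V ->
  (forall i, `|g i| <= 1) -> (forall i, `|h i| <= 1) ->
  (forall i, `|g i - h i| <= eta) ->
  `|frob (V *m (diagf g *m W)) - frob (V *m (diagf h *m W))| <= 2 * eta * frob W.
Proof.
move=> eta0 hV g1 h1 gh; rewrite -(ler_pM2l eta0).
set X := V *m (diagf g *m W); set Y := V *m (diagf h *m W).
apply: (@le_trans _ _ (frob (X - Y) + (eta / 2) ^+ 2 * frob (X + Y))).
  have -> : eta * `|frob X - frob Y| =
      `|\sum_i \sum_j eta * (`|X i j| ^+ 2 - `|Y i j| ^+ 2)|.
    rewrite -{1}(ger0_norm (ltW eta0)) -normrM; congr `|_|.
    rewrite /frob -sumrB mulr_sumr; apply: eq_bigr => i _.
    by rewrite -sumrB mulr_sumr.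
  rewrite /frob mulr_sumr -big_split /=.
  apply: le_trans (ler_norm_sum _ _ _) _; apply: ler_sum => i _.
  rewrite mulr_sumr -big_split /=.
  apply: le_trans (ler_norm_sum _ _ _) _; apply: ler_sum => j _.
  by rewrite normrM (ger0_norm (ltW eta0)) !mxE; apply: sqr_norm_diff; rewrite ltW.
have -> : eta * (2 * eta * frob W) =
    eta ^+ 2 * frob W + (eta / 2) ^+ 2 * (2 ^+ 2 * frob W) by field.
apply: lerD.
  have -> : X - Y = V *m (diagf (fun i => g i - h i) *m W).
    rewrite -mulmxBr -mulmxBl; congr (_ *m (_ *m _)).
    by apply/matrixP => i k; rewrite !mxE mulrnBl.
  by apply: (le_trans (hV _)); apply: frob_diagf.
have e2 : 0 <= (eta / 2) ^+ 2 by rewrite exprn_ge0 // divr_ge0 ?ler0n // ltW.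
rewrite (ler_wpM2l e2) //.
have -> : X + Y = V *m (diagf (fun i => g i + h i) *m W).
  rewrite -mulmxDr -mulmxDl; congr (_ *m (_ *m _)).
  by apply/matrixP => i k; rewrite !mxE mulrnDl.
apply: (le_trans (hV _)); apply: frob_diagf => i.
by rewrite (le_trans (ler_normD _ _)) // (_ : 2 = 1 + 1) // lerD.
Qed.

(** The factors are exchanged one at a time, the others having norm at most 1. *)
Lemma norm_prod_diff (I : eqType) (r : seq I) (P : pred I) (g h : I -> C) (e : C) :
  (forall S, P S -> `|g S| <= 1 /\ `|h S| <= 1) ->
  (forall S, P S -> `|g S - h S| <= e) ->
  [/\ `|\prod_(S <- r | P S) g S| <= 1, `|\prod_(S <- r | P S) h S| <= 1 &
    `|\prod_(S <- r | P S) g S - \prod_(S <- r | P S) h S| <= \sum_(S <- r | P S) e].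
Proof.
move=> h1 gh; elim: r => [|S r [IH1 IH2 IH3]].
  by rewrite !big_nil subrr normr0 normr1.
rewrite !big_cons; case: ifP => PS //; have [a1 a2] := h1 S PS.
split; rewrite ?normrM ?mulr_ile1 //.
set G := \prod_(_ <- _ | _) _ in IH1 *; set H := \prod_(_ <- _ | _) _ in IH2 *.
have -> : g S * G - h S * H = (g S - h S) * G + h S * (G - H) by ring.
rewrite (le_trans (ler_normD _ _)) // !normrM; apply: lerD.
  by apply: le_trans (gh S PS); rewrite ler_piMr.
by apply: le_trans IH3; rewrite ler_piMl.
Qed.
End Contractions.

(** * Comparison of exact and approximate circuits *)

Section Circuits.
Variables (R : realType) (m : nat).
Local Notation C := R[i].
Local Notation N := (2 ^ m)%N.

Lemma norm_complex_le (x e : R) : (`|x%:C%C| <= e%:C%C :> C) = (`|x| <= e).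
Proof.
rewrite real_ler_norml; last by apply/complex_realP; exists x.
by rewrite -rmorphN !lecR ler_norml.
Qed.

Lemma norm_dist_trans (x y z e1 e2 : C) :
  `|x - y| <= e1 -> `|y - z| <= e2 -> `|x - z| <= e1 + e2.
Proof. by move=> h1 h2; rewrite (le_trans (ler_distD y x z)) // lerD. Qed.

Lemma approx_gate_close b tau (S : {set 'I_m}) (i : 'I_N) : (0 < b)%N ->
  [/\ `|approx_gate R b tau S i| <= 1, `|czgate R S i| <= 1 &
    `|approx_gate R b tau S i - czgate R S i| <= 2 / (4 ^ tau)%:R].
Proof.
move=> b0.
have c1 : `|czgate R S i| <= 1 by rewrite /czgate; case: ifP; rewrite ?normrN normr1.
have e0 : 0 <= 2 / (4 ^ tau)%:R :> C by rewrite divr_ge0.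
rewrite /approx_gate; case: leqP => Sb; first by rewrite subrr normr0.
set r := (#|S| %/ b).+1.
have s0 : (0 < #|S|)%N by apply: leq_trans Sb.
have [E|E] := eqVneq (ones S i) #|S|.
  rewrite E and_polyE1 // /czgate -ones_full E eqxx.
  rewrite (_ : (1 - 2 * 1 : R)%:C%C = -1); last by rewrite rmorphB rmorphM rmorph1 rmorph_nat; ring.
  by rewrite subrr normr0 normrN normr1.
have lt : (ones S i < #|S|)%N by rewrite ltn_neqAle E ones_le.
(* From b^2 < |S| < b r follows b < r, hence |S| < b r <= r^2. *)
have sr : (#|S| <= r ^ 2)%N.
  have h1 : (#|S| < b * r)%N by rewrite mulnC ltn_ceil.
  have h2 : (b < r)%N.
    by rewrite -(ltn_pmul2l b0); apply: leq_ltn_trans h1; rewrite mulnn ltnW.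
  by apply: leq_trans (ltnW h1) _; rewrite expnS expn1 leq_mul2r ltnW ?orbT.
have p0 := and_poly_ge0 #|S| r tau ((ones S i)%:R : R).
have p1 := and_poly_small R tau sr lt; set p := _.[_] in p0 p1 *.
have q1 : ((4 ^ tau)%:R : R)^-1 <= 1 by rewrite invf_le1 ?ltr0n ?expn_gt0 // ler1n expn_gt0.
have n4 : (2 / (4 ^ tau)%:R : C) = (2 * ((4 ^ tau)%:R)^-1 : R)%:C%C.
  by rewrite rmorphM fmorphV !rmorph_nat.
rewrite /czgate -ones_full (negbTE E) n4 normr1.
have -> : ((1 - 2 * p)%:C - 1)%C = ((- (2 * p)))%:C%C :> C.
  by rewrite !rmorphB rmorph1 rmorphN; ring.
have n1 : 1 = (1 : R)%:C%C :> C by [].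
by rewrite {1}n1 !norm_complex_le lexx; split=> //; rewrite ler_norml; lra.
Qed.

Lemma card_trivIset_le (P : {set {set 'I_m}}) : trivIset P -> set0 \notin P ->
  (#|P| <= m)%N.
Proof.
move=> tP P0; apply: (@leq_trans (\sum_(S in P) #|S|)).
  rewrite -sum1_card; apply: leq_sum => S SP; rewrite card_gt0.
  by apply: contraNneq P0 => <-.
by move/eqP: tP => ->; rewrite -[X in (_ <= X)%N](card_ord m) max_card.
Qed.

(** There are at most [m] gates, each with error 2 / 4^tau, and m^2 <= 4^tau. *)
Lemma approx_cz_close b tau (P : {set {set 'I_m}}) i : (0 < b)%N ->
  (0 < m)%N -> (m <= 2 ^ tau)%N -> cz_layer_ok P ->
  [/\ `|\prod_(S in P) approx_gate R b tau S i| <= 1,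
    `|\prod_(S in P) czgate R S i| <= 1 &
    `|\prod_(S in P) approx_gate R b tau S i - \prod_(S in P) czgate R S i| <= 2 / m%:R].
Proof.
move=> b0 m0 mt [tP P0].
have [||h1 h2 h3] := @norm_prod_diff R _ (index_enum {set 'I_m}) (fun S => S \in P)
  (fun S => approx_gate R b tau S i) (fun S => czgate R S i) (2 / (4 ^ tau)%:R).
- by move=> S _; have [] := approx_gate_close tau S i b0.
- by move=> S _; have [] := approx_gate_close tau S i b0.
split=> //; apply: le_trans h3 _; rewrite sumr_const -[X in X <= _]mulr_natr.
rewrite -mulrA ler_wpM2l // mulrC ler_pdivrMr ?ltr0n ?expn_gt0 // mulrC.
rewrite ler_pdivlMr ?ltr0n // -natrM ler_nat (expnMn 2 2).
by rewrite leq_mul // (leq_trans (card_trivIset_le tP P0)).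
Qed.

Lemma czlayer_unitary (P : {set {set 'I_m}}) : czlayer R P \is unitarymx.
Proof.
rewrite czlayerE; apply/unitarymxP; rewrite -/(dagger _) dagger_diagf; last first.
  move=> i; apply: rpred_prod => S _.
  by rewrite /czgate; case: ifP => _; rewrite ?rpredN rpred1.
rewrite diagfM; apply/matrixP => i k; rewrite diagfE mxE -big_split /=.
by rewrite big1 // => S _; rewrite czgate_sqr.
Qed.

Variables (d : nat) (c : qac0 R m d).
Hypothesis c_ok : qac0_ok c.

Fixpoint acirc (b : nat -> nat) (tau t : nat) : 'M[C]_N :=
  match t with
  | 0 => layer1 (Lay c 0)
  | t'.+1 => layer1 (Lay c t) *m approx_cz R (b t) tau (CZ c t) *m acirc b tau t'
  end.

Lemma Lay_unitary t : (t <= d)%N -> layer1 (Lay c t) \is unitarymx.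
Proof. by move=> td; apply: layer1_unitary => j; apply: c_ok.1. Qed.

Lemma circ_upto_unitary t : (t <= d)%N -> circ_upto c t \is unitarymx.
Proof.
elim: t => [|t IH] td /=; first exact: Lay_unitary.
by rewrite !mul_unitarymx ?Lay_unitary ?czlayer_unitary ?IH // ltnW.
Qed.

(** A hybrid argument: [V] collects the later layers, already approximated and therefore only
    contractions, while the earlier layers are still exact and preserve the norm of [W]. Each
    exchange costs 2 * (2 / m) by [contraction_diff]. *)
Lemma acirc_close b tau t p q (V : 'M[C]_(p, N)) (W : 'M[C]_(N, q)) :
  (forall s, 0 < b s)%N -> (0 < m)%N -> (m <= 2 ^ tau)%N -> (t <= d)%N ->
  contraction q V ->
  `|frob (V *m (acirc b tau t *m W)) - frob (V *m (circ_upto c t *m W))|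
    <= 4 * t%:R / m%:R * frob W.
Proof.
move=> b0 m0 mt; elim: t p V => [|t IH] p V td hV.
  by rewrite subrr normr0 mulr0 !mul0r.
have cz i := @approx_cz_close _ tau (CZ c t.+1) i (b0 t.+1) m0 mt (c_ok.2 t.+1 td).
pose V1 := V *m layer1 (Lay c t.+1).
have hV1 : contraction q V1.
  by move=> X; rewrite -mulmxA (le_trans (hV _)) // frob_unitary ?Lay_unitary.
pose V2 := V1 *m approx_cz R (b t.+1) tau (CZ c t.+1).
have hV2 : contraction q V2.
  move=> X; rewrite -mulmxA (le_trans (hV1 _)) // -[leRHS]mul1r -(expr1n _ 2).
  by apply: frob_diagf => i; have [] := cz i.
have m0' : (0 : C) < m%:R by rewrite ltr0n.
set U := circ_upto c t *m W.
have h2 : `|frob (V1 *m (approx_cz R (b t.+1) tau (CZ c t.+1) *m U))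
    - frob (V1 *m (czlayer R (CZ c t.+1) *m U))| <= 2 * (2 / m%:R) * frob U.
  by apply: contraction_diff => //; [exact: divr_gt0|..] => i; have [] := cz i.
have h1 := IH _ V2 (ltnW td) hV2.
have e1 : V *m (acirc b tau t.+1 *m W) = V2 *m (acirc b tau t *m W).
  by rewrite /V2 /V1 !mulmxA.
have e2 : V *m (circ_upto c t.+1 *m W) = V1 *m (czlayer R (CZ c t.+1) *m U).
  by rewrite /U /V1 !mulmxA.
have e3 : V2 *m U = V1 *m (approx_cz R (b t.+1) tau (CZ c t.+1) *m U).
  by rewrite /V2 mulmxA.
rewrite -/U e3 in h1; rewrite e1 e2; apply: le_trans (norm_dist_trans h1 h2) _.
have -> : 4 * t.+1%:R / m%:R * frob W = 4 * t%:R / m%:R * frob W + 2 * (2 / m%:R) * frob W.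
  by rewrite -(natr1 t); field; rewrite gt_eqF.
have w0 : 0 <= 2 * (2 / m%:R) :> C by rewrite mulr_ge0 // divr_ge0.
by rewrite lerD2l (ler_wpM2l w0) // frob_unitary // circ_upto_unitary // ltnW.
Qed.

Lemma dagger_approx_cz b tau (P : {set {set 'I_m}}) :
  dagger (approx_cz R b tau P) = approx_cz R b tau P.
Proof.
apply: dagger_diagf => i; apply: rpred_prod => S _.
rewrite /approx_gate /czgate; case: ifP => _; last first.
  by apply/complex_realP; eexists.
by case: ifP => _; rewrite ?rpredN rpred1.
Qed.

(* The Heisenberg evolution peels off the layers from the last to the first. *)
Lemma acirc_deg b tau (D : nat -> nat) :
  (forall s, 0 < b s)%N ->
  (forall t A, (t < d)%N -> deg_le (D t.+1) A ->
     deg_le (D t) (approx_cz R (b t.+1) tau (CZ c t.+1) *m A *m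
                   approx_cz R (b t.+1) tau (CZ c t.+1))) ->
  forall t A, (t <= d)%N -> deg_le (D t) A ->
  deg_le (D 0%N) (dagger (acirc b tau t) *m A *m acirc b tau t).
Proof.
move=> b0 hD; elim=> [|t IH] A td hA /=.
  by apply: deg_le_conj_layer1 => // j; apply: c_ok.1.
rewrite !daggerM dagger_approx_cz.
set L := layer1 _; set M := approx_cz _ _ _ _; set B := acirc _ _ _.
have -> : dagger B *m (M *m dagger L) *m A *m (L *m M *m B) =
  dagger B *m (M *m (dagger L *m A *m L) *m M) *m B by rewrite !mulmxA.
apply: IH; first exact: ltnW.
by apply: hD => //; apply: deg_le_conj_layer1 => // j; apply: c_ok.1.
Qed.
End Circuits.

(** * Juntas and input states *)

Section Juntas.
Variables (R : realType) (n : nat).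
Implicit Types (x : bits n) (g h f : bits n -> R).

Definition flip (j : 'I_n) x : bits n := [ffun i => (i == j) (+) x i].

Lemma flipK j : involutive (flip j).
Proof. by move=> x; apply/ffunP => i; rewrite !ffunE addKb. Qed.

(** Invariance under single flips is what commutation with a bit-flip operator on one qubit yields
    directly. *)
Definition junta (W : {set 'I_n}) h : Prop :=
  forall x j, j \notin W -> h (flip j x) = h x.

(** The classical counterpart of [deg_le]; the pointwise equations avoid having to prove equalities
    between functions. *)
Inductive jdeg_le (l : nat) : (bits n -> R) -> Prop :=
  | jdeg_le0 g : (forall x, g x = 0) -> jdeg_le l g
  | jdeg_leD (W : {set 'I_n}) h g f : (#|W| <= l)%N -> junta W h ->
      jdeg_le l g -> (forall x, f x = h x + g x) -> jdeg_le l f.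

Lemma eq_jdeg_le l g h : g =1 h -> jdeg_le l g -> jdeg_le l h.
Proof.
move=> gh hg; case: hg gh => [g' g0|W h' g' f Wl hW hg' fE] gh.
  by apply: jdeg_le0 => x; rewrite -gh.
by apply: (jdeg_leD Wl hW hg') => x; rewrite -gh.
Qed.

Lemma jdeg_le_junta l (W : {set 'I_n}) h : (#|W| <= l)%N -> junta W h -> jdeg_le l h.
Proof.
move=> Wl hW; apply: (jdeg_leD Wl hW (@jdeg_le0 l (fun=> 0) (fun=> erefl))) => x.
by rewrite addr0.
Qed.

Lemma jdeg_le_add l g h : jdeg_le l g -> jdeg_le l h -> jdeg_le l (fun x => g x + h x).
Proof.
elim=> [g' g0|W h' g' f Wl hW _ IH fE] hh.
  by apply: eq_jdeg_le hh => x; rewrite g0 add0r.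
by apply: (jdeg_leD Wl hW (IH hh)) => x; rewrite fE addrA.
Qed.

Lemma jdeg_le_sub l l' g : (l <= l')%N -> jdeg_le l g -> jdeg_le l' g.
Proof.
move=> ll; elim=> [g' g0|W h' g' f Wl hW _ IH fE]; first exact: jdeg_le0.
by apply: jdeg_leD hW IH fE; apply: leq_trans ll.
Qed.

Lemma jdeg_le_mul l l' g h : jdeg_le l g -> jdeg_le l' h ->
  jdeg_le (l + l') (fun x => g x * h x).
Proof.
move=> hg; elim=> [h' h0|V s h' f Vl hV _ IH fE].
  by apply: jdeg_le0 => x; rewrite h0 mulr0.
apply: (@eq_jdeg_le _ (fun x => g x * s x + g x * h' x)).
  by move=> x; rewrite fE mulrDr.
apply: jdeg_le_add => //.
elim: hg {IH} => [g' g0|W s' g' f' Wl hW _ IH fE'].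
  by apply: jdeg_le0 => x; rewrite g0 mul0r.
apply: (@jdeg_leD _ (W :|: V) (fun x => s' x * s x)) IH _.
- by rewrite (leq_trans (leq_card_setU _ _)) ?leq_add.
- by move=> x j; rewrite inE negb_or => /andP[jW jV]; rewrite hW ?hV.
- by move=> x; rewrite fE' mulrDl.
Qed.

Lemma jdeg_le_cst l c : jdeg_le l (fun=> c).
Proof. by apply: (@jdeg_le_junta _ set0); rewrite ?cards0. Qed.

Lemma chi_flip (S : {set 'I_n}) j x : j \in S -> chi R S (flip j x) = - chi R S x.
Proof.
move=> jS; rewrite /chi.
have E y : [set i in S | y i] = if y j then j |: [set i in S :\ j | y i]
    else [set i in S :\ j | y i] :> {set 'I_n}.
  case yj: (y j); apply/setP => i; rewrite !inE; have [->|] := eqVneq i j;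
  by rewrite ?yj ?jS ?andbF.
have E2 : [set i in S :\ j | flip j x i] = [set i in S :\ j | x i].
  by apply/setP => i; rewrite !inE ffunE; case: eqVneq.
rewrite [in LHS]E [in RHS]E E2 ffunE eqxx.
case: (x j) => /=; rewrite cardsU1 !inE eqxx /= exprS ?mulN1r ?opprK //.
Qed.

(** Flipping a bit of [S] outside [W] keeps [h] and negates the character, so the sum equals its own
    negative. *)
Lemma fourier_junta (W S : {set 'I_n}) h : junta W h -> ~~ (S \subset W) ->
  \sum_(x : bits n) h x * chi R S x = 0.
Proof.
move=> hW /subsetPn[j jS jW]; set s := \sum_(_ | _) _.
suff : s = - s by lra.
rewrite {1}/s (reindex_inj (inv_inj (flipK j))) /= -sumrN.
by apply: eq_bigr => x _; rewrite hW // chi_flip // mulrN.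
Qed.

Lemma fdeg_jdeg_le l g : jdeg_le l g -> (fdeg g <= l)%N.
Proof.
move=> hg; apply/bigmax_leqP => S; apply: contraR; rewrite -ltnNge => lS.
suff : \sum_(x : bits n) g x * chi R S x = 0 by rewrite /fourier => ->; rewrite mulr0.
elim: hg => [g' g0|W h g' f Wl hW _ IH fE].
  by rewrite big1 // => x _; rewrite g0 mul0r.
under eq_bigr do rewrite fE mulrDl.
rewrite big_split /= IH (fourier_junta hW) ?addr0 //.
by apply: contraL lS => /subset_leq_card SW; rewrite -leqNgt (leq_trans SW).
Qed.
End Juntas.

Section InputState.
Variables (R : realType) (n a : nat).
Local Notation C := R[i].
Local Notation N := (2 ^ (n + a))%N.
Implicit Types (x : bits n) (phi K : 'M[C]_(2 ^ a)).

Lemma basis_lt x (k : 'I_(2 ^ a)) : (bits_num x + 2 ^ n * k < N)%N.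
Proof.
rewrite expnD; apply: (@leq_trans (2 ^ n * k.+1)); last by rewrite leq_mul2l ltn_ord orbT.
by rewrite mulnS ltn_add2r bits_num_lt.
Qed.

Definition basis x (k : 'I_(2 ^ a)) : 'I_N := Ordinal (basis_lt x k).

Lemma eq_basis x (k : 'I_(2 ^ a)) (i : 'I_N) : (forall j : 'I_n, bitn i j = x j) ->
  (forall j : 'I_a, bitn i (n + j) = bitn k j) -> i = basis x k.
Proof.
move=> h1 h2; apply/val_inj/(@bitn_ext (n + a)); [exact: ltn_ord|exact: ltn_ord|].
move=> j jm; have [jn|nj] := ltnP j n.
  by have := h1 (Ordinal jn); rewrite -(bitn_bits_num x k).
rewrite /= bitn_bits_num_high //; have ja : (j - n < a)%N by lia.
by rewrite -(h2 (Ordinal ja)) /= subnKC.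
Qed.

Lemma basis_inj x : injective (basis x).
Proof.
move=> k k' /(congr1 val)/= /addnI/eqP; rewrite eqn_pmul2l ?expn_gt0 // => /eqP.
exact: val_inj.
Qed.

(** The isometry |k> -> |x>|k>; conjugating [phi] by it gives the input state. *)
Definition inject x : 'M[C]_(N, 2 ^ a) := \matrix_(i, k) (i == basis x k)%:R.

Lemma input_stateE x phi : input_state x phi = inject x *m phi *m dagger (inject x).
Proof.
apply/matrixP => i i'; rewrite !mxE exchange_big; apply: eq_bigr => k' _.
rewrite daggerE !mxE mulr_suml; apply: eq_bigr => k _.
rewrite mxE rmorph_nat -!val_eqE /=.
by case: eqP => _; case: eqP => _; rewrite ?mul0r ?mulr0 // mul1r mulr1.
Qed.

Lemma inject_isometry x : dagger (inject x) *m inject x = 1%:M.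
Proof.
apply/matrixP => k k'; rewrite !mxE (bigD1 (basis x k)) //= daggerE !mxE eqxx.
rewrite rmorph1 mul1r (inj_eq (@basis_inj x)) big1 ?addr0 // => i /negbTE ik.
by rewrite daggerE !mxE ik rmorph0 mul0r.
Qed.

Definition pauliX : 'M[C]_2 := \matrix_(b, b') (b != b')%:R.

Lemma pauliX_unitary : pauliX \is unitarymx.
Proof.
apply/unitarymxP/matrixP => b b'; rewrite !mxE big_ord_recl big_ord1 !mxE !rmorph_nat.
by case: b => [[|[|b]] hb] //; case: b' => [[|[|b']] hb'] //=;
  rewrite ?eqE /= ?mulr0 ?mulr1 ?addr0 ?add0r.
Qed.

Lemma inject_flip x (j : 'I_n) :
  onqubit (lshift a j) pauliX *m inject x = inject (flip j x).
Proof.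
apply/matrixP => i k; rewrite mxE (bigD1 (basis x k)) //= [inject _ _ _]mxE eqxx mulr1.
rewrite big1 ?addr0; last first.
  by move=> l /negbTE lk; rewrite [inject _ _ _]mxE lk mulr0.
rewrite [RHS]mxE.
have B (q : 'I_n) y : bitn (basis y k) (lshift a q) = y q by apply: bitn_bits_num.
have B' (q : 'I_a) y : bitn (basis y k) (rshift n q) = bitn k q.
  by rewrite /= bitn_bits_num_high ?leq_addr // addKn.
have [->|ik] := eqVneq i (basis (flip j x) k).
  rewrite mxE big1 // => j' _; case: (split_ordP j') => q ->; last first.
    by rewrite eq_rlshift mxE !B' eqxx.
  rewrite (inj_eq (@lshift_inj _ _)) !B ffunE; case: eqP => [->|_]; rewrite mxE ?eqxx //.
  by rewrite (inj_eq b2I_inj); case: (x j).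
apply/eqP; apply: contraNT ik; rewrite mxE prodf_seq_neq0 => /allP h; apply/eqP.
have {}h j' : (if j' == lshift a j then pauliX else 1%:M)
    (b2I (bitn i j')) (b2I (bitn (basis x k) j')) != 0.
  exact: h (mem_index_enum j').
apply: eq_basis => q.
  have := h (lshift a q); rewrite (inj_eq (@lshift_inj _ _)) B ffunE.
  case: (q =P j) => [->|_]; last by move/scalar_mx_neq0/b2I_inj.
  by rewrite mxE (inj_eq b2I_inj); case: (x j); case: bitn; rewrite ?eqxx.
by have := h (rshift n q); rewrite eq_rlshift B' => /scalar_mx_neq0/b2I_inj.
Qed.

(** For an input qubit outside [W], the Pauli X on it carries the input state of x to that of the
    flipped x. It commutes with [T], so it cancels under the trace. *)
Lemma local_junta (W : {set 'I_(n + a)}) (T : 'M[C]_N) phi : local W T ->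
  junta [set j | lshift a j \in W] (fun x => complex.Re (\tr (T *m input_state x phi))).
Proof.
move=> hT x j; rewrite inE => jW; congr complex.Re.
have U : onqubit (lshift a j) pauliX \is unitarymx.
  apply: layer1_unitary => j'; case: ifP => _; first exact: pauliX_unitary.
  by apply/unitarymxP; rewrite trmx1 map_mx1 mulmx1.
rewrite !input_stateE -inject_flip daggerM.
set E := onqubit _ _ in U *; set V := inject x.
rewrite !mulmxA hT // mxtrace_mulC !mulmxA unitary_mull // mul1mx.
by [].
Qed.

Lemma deg_le_jdeg_le l (A : 'M[C]_N) phi : deg_le l A ->
  jdeg_le l (fun x => complex.Re (\tr (A *m input_state x phi))).
Proof.
elim=> [|W T B Wl hT _ IH].
  by apply: jdeg_le0 => x; rewrite mul0mx mxtrace0.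
apply: jdeg_leD (local_junta phi hT) IH _; last first.
  by move=> x; rewrite mulmxDl mxtraceD raddfD.
apply: leq_trans Wl; rewrite -(card_imset _ (@lshift_inj n a)).
by apply: subset_leq_card; apply/subsetP => _ /imsetP[j + ->]; rewrite inE.
Qed.

(** The spectral theorem with square roots of the eigenvalues. Writing [phi] in this way turns
    outcome probabilities into values of [frob], to which the error estimates apply. *)
Lemma psd_sqrt k (phi : 'M[C]_k) : is_state phi -> exists K : 'M_k, phi = K *m dagger K.
Proof.
case=> herm [psd _].
have nphi : phi \is normalmx.
  by apply/normalmxP; rewrite -/(dagger phi) herm.
have /orthomx_spectralP E := nphi.
set P := spectralmx phi in E; set D := spectral_diag phi in E.
have Pu : P \is unitarymx by apply: spectral_unitarymx.
rewrite invmx_unitary // -/(dagger P) in E.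
(* The quadratic form of [phi] at row [i] of [P], an eigenvector, is the eigenvalue. *)
have D0 i : 0 <= D 0 i.
  have := psd (row i P); rewrite E.
  have -> : row i P *m (dagger P *m diag_mx D *m P) *m dagger (row i P) =
    row i (P *m dagger P *m diag_mx D *m P) *m dagger (row i P).
    by rewrite !row_mul !mulmxA.
  rewrite unitary_mulr // mul1mx row_mul -mulmxA.
  have -> : P *m dagger (row i P) = col i (1%:M).
    rewrite -(unitary_mulr Pu); apply/matrixP => u v; rewrite !mxE.
    by apply: eq_bigr => l _; rewrite !mxE.
  rewrite mxE (bigD1 i) //= !mxE eqxx mulr1n mulr1 big1 ?addr0 // => u /negbTE ui.
  by rewrite !mxE ui mulr0.
exists (dagger P *m diag_mx (map_mx sqrtC D)).
rewrite daggerM daggerK mulmxA -(mulmxA (dagger P)) E; congr (_ *m _ *m _).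
apply/matrixP => i k'; rewrite mul_diag_mx [RHS]mxE daggerE !mxE.
rewrite eq_sym; case: eqP => [->|_]; last by rewrite !mulr0n rmorph0 mulr0.
rewrite !mulr1n geC0_conj ?sqrtC_ge0 ?D0 //.
by rewrite -expr2 sqrtCK.
Qed.
End InputState.

(** * Approximating the acceptance probability *)

Section ApproxDegree.
Variable R : realType.

Section Scalars.
Variables (m : nat).
Hypothesis m0 : (0 < m)%N.

(* The degree of the observable after s layers is kept below a multiple of
   m / beta s, with the threshold b close to beta s.+1 / 2 in the next layer. *)
Definition beta (s : nat) : R := powR m%:R ((3 ^ s)%:R^-1).

Lemma beta_ge1 s : 1 <= beta s.
Proof.
rewrite -[1](powRr0 m%:R) /beta; apply: ler_powR; last by rewrite invr_ge0.
by rewrite ler1n.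
Qed.

Lemma betaS s : beta s.+1 ^+ 3 = beta s.
Proof.
rewrite /beta -powR_mulrn ?powR_ge0 // -powRrM; congr powR.
by rewrite expnS natrM invfM mulrAC mulVf ?mul1r ?pnatr_eq0.
Qed.

Lemma beta0 : beta 0 = m%:R.
Proof. by rewrite /beta expn0 invr1 powRr1. Qed.

Lemma div_beta s : m%:R / beta s = powR m%:R (1 - (3 ^ s)%:R^-1).
Proof. by rewrite powRB ?powRr1 // ?pnatr_eq0 -?lt0n ?m0 ?implybT. Qed.

(** Since x > 64, rounding is harmless: x / 2 < b <= 3 x / 4. With q = tau m / x the exact gates
    give at most 64 q * (3 / 4)^2 = 36 q and the approximated ones 2 * 8 q, in total 52 q, below the
    allowed 64 q. *)
Lemma degree_step (tau cost l : nat) (x : R) :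
  let b := (Num.truncn (x / 2)).+1 in
  (0 < tau)%N -> 64 * tau%:R < x -> (b * cost <= 4 * tau * m)%N ->
  l%:R <= 64 * tau%:R * m%:R / x ^+ 3 ->
  (l * b ^ 2 + 2 * cost)%:R <= 64 * tau%:R * m%:R / x.
Proof.
move=> b tau0 xt; rewrite -(ler_nat R) !natrM => hc hl.
have t1 : 1 <= tau%:R :> R by rewrite ler1n.
have x64 : 64 < x by lra.
have x0 : 0 < x by lra.
have /andP[b1 b2] : (Num.truncn (x / 2))%:R <= x / 2 < b%:R.
  by apply: truncn_itv; lra.
have b3 : b%:R <= 3 / 4 * x by rewrite /b -natr1; lra.
rewrite natrD natrM natrX natrM.
set q := tau%:R * m%:R / x.
have q0 : 0 <= q by rewrite divr_ge0 ?mulr_ge0 // ltW.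
have tm : tau%:R * m%:R = q * x by rewrite /q divfK ?gt_eqF.
have c1 : cost%:R <= 8 * q.
  have : x / 2 * cost%:R <= 4 * q * x.
    apply: le_trans (_ : b%:R * cost%:R <= _); first by rewrite ler_wpM2r // ltW.
    by rewrite -mulrA -tm mulrA.
  by rewrite (_ : x / 2 * cost%:R = cost%:R / 2 * x) ?ler_pM2r //; [lra|field].
have l1 : l%:R * b%:R ^+ 2 <= 36 * q.
  apply: (@le_trans _ _ (64 * tau%:R * m%:R / x ^+ 3 * (3 / 4 * x) ^+ 2)).
    by apply: ler_pM => //; rewrite ?exprn_ge0 // lerXn2r ?nnegrE //; lra.
  by rewrite le_eqVlt; apply/orP; left; apply/eqP; rewrite /q; field; rewrite gt_eqF.
have -> : 64 * tau%:R * m%:R / x = 64 * q by rewrite /q !mulrA.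
lra.
Qed.

Definition log_cap : nat := (trunc_log 2 m).+1.

Lemma log_cap_le : (log_cap)%:R <= 2 * (1 + ln m%:R) :> R.
Proof.
have m1 : 1 <= m%:R :> R by rewrite ler1n.
(* This is ln (1 + y) <= y at y = -1/2; it accounts for the factor 2 in the bound. *)
have l2 : 1 / 2 <= ln 2 :> R.
  have : ln (1 + (- (1 / 2))) <= - (1 / 2) :> R by apply: le_ln1Dx; lra.
  by rewrite (_ : 1 + - (1 / 2) = 2^-1) ?lnV ?posrE //; [lra|field].
set T := trunc_log 2 m.
have h : ln 2 * T%:R <= ln m%:R :> R.
  rewrite mulr_natr -lnXn // -natrX ler_ln ?posrE ?ltr0n ?expn_gt0 //.
  by rewrite ler_nat trunc_logP.
have : 0 <= (ln 2 - 1 / 2) * T%:R :> R by rewrite mulr_ge0 // subr_ge0.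
by rewrite mulrBl /log_cap -/T -(natr1 T); lra.
Qed.
End Scalars.

Lemma frob_proj m q b (A : 'M[R[i]]_(2 ^ m, q)) :
  frob (diagf (fun i => (bitn i 0 == b)%:R) *m A) =
  \sum_(i < 2 ^ m | bitn i 0 == b) (A *m dagger A) i i.
Proof.
rewrite [RHS]big_mkcond; apply: eq_bigr => i _; rewrite mxE.
case: ifP => bi; last first.
  by rewrite big1 // => j _; rewrite mul_diagf bi mul0r normr0 expr0n.
by apply: eq_bigr => j _; rewrite mul_diagf bi mul1r daggerE normCK.
Qed.

Lemma frob_proj_sum m q b (A : 'M[R[i]]_(2 ^ m, q)) :
  frob (diagf (fun i => (bitn i 0 == b)%:R) *m A) +
  frob (diagf (fun i => (bitn i 0 == ~~ b)%:R) *m A) = frob A.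
Proof.
rewrite -big_split; apply: eq_bigr => i _; rewrite -big_split; apply: eq_bigr => j _ /=.
rewrite !mul_diagf; case: (bitn i 0); case: b;
  by rewrite /= ?mul1r ?mul0r normr0 expr0n ?addr0 ?add0r.
Qed.

Lemma contraction_proj m q b :
  @contraction R m q _ (diagf (fun i : 'I_(2 ^ m) => (bitn i 0 == b)%:R : R[i])).
Proof. by move=> A; rewrite -(frob_proj_sum b A) lerDl frob_ge0. Qed.

Lemma circuit_approx (n a d : nat) (phi : 'M[R[i]]_(2 ^ a)) (c : qac0 R (n + a) d)
    (f : bits n -> bool) (delta : R) :
  (0 < n)%N -> is_state phi -> qac0_ok c -> computes_with_error c phi f delta ->
  exists (l : nat) (g : bits n -> R),
    [/\ jdeg_le l g,
        l%:R <= 128 * (1 + ln ((n + a)%:R : R)) * powR ((n + a)%:R : R) (1 - (3 ^ d)%:R^-1) &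
        forall x, `|(f x)%:R - g x| <= delta + 4 * d%:R / n%:R].
Proof.
move=> n0 phi_ok c_ok hf; set m := (n + a)%N.
have m0 : (0 < m)%N by rewrite addn_gt0 n0.
set tau := log_cap m; have tau0 : (0 < tau)%N by [].
have mtau : (m <= 2 ^ tau)%N by rewrite ltnW // trunc_log_ltn.
(* Layer t is the (d + 1 - t)-th to be peeled off, which fixes its threshold; [D t] bounds the
   degree once layers t + 1, ..., d are gone. At the start [beta m 0] is [m], so [D d] is 64 tau,
   enough for a one-qubit projector. *)
pose b t := (Num.truncn (beta m (d.+1 - t) / 2)).+1.
have b0 t : (0 < b t)%N by [].
pose D t := Num.truncn (64 * tau%:R * m%:R / beta m (d - t)).
have bet0 s : 0 < beta m s by apply: lt_le_trans (beta_ge1 m0 s).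
have Q0 s : 0 <= 64 * tau%:R * m%:R / beta m s.
  by rewrite divr_ge0 ?mulr_ge0 // ltW.
pose P1 : 'M[R[i]]_(2 ^ m) := diagf (fun i => (bitn i 0 == true)%:R).
have P1d : dagger P1 = P1 by apply: dagger_diagf => i; apply: realn.
have P1P1 : P1 *m P1 = P1.
  rewrite diagfM; apply: eq_diagf => i.
  by case: (_ == _); rewrite ?mulr1 ?mulr0.
pose B := acirc c b tau d.
have DP : deg_le (D d) P1.
  have D1 : (1 <= D d)%N.
    rewrite truncn_gt0 subnn beta0 mulfK ?pnatr_eq0 -?lt0n //.
    by rewrite -natrM ler1n muln_gt0.
  apply: deg_le_sub D1 _; apply: (@fdeg_le_depends _ _ _ [set Ordinal m0]).
    by rewrite cards1.
  by move=> i k /(_ (Ordinal m0)); rewrite set11 /= => ->.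
have hB : deg_le (D 0%N) (dagger B *m P1 *m B).
  apply: (acirc_deg c_ok b0) DP => // t A td hA.
  have [tP _] := c_ok.2 t.+1 td.
  have E : (d - t = (d - t.+1).+1)%N by rewrite subnSK.
  (* If [beta] is at most 64 tau, the claimed bound is at least [m] and holds trivially; otherwise
     [degree_step] applies. *)
  have [small|big] := leP (beta m (d - t)) (64 * tau%:R).
    apply: deg_le_sub (deg_le_max _); rewrite truncn_ge_nat // ler_pdivlMr //.
    by rewrite mulrC ler_wpM2r.
  apply: deg_le_sub (approx_cz_deg tau (b0 t.+1) tP hA).
  rewrite truncn_ge_nat // /b subSS; apply: degree_step => //.
    by rewrite -[X in (X.+1 * _)%N]/(Num.truncn _) -/(b t.+1) large_cost_le.
  by rewrite E betaS truncn_le.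
have [K KE] := psd_sqrt phi_ok.
pose W (x : bits n) := inject R a x *m K.
have fW x : frob (W x) = 1.
  rewrite frobE daggerM -mulmxA (mulmxA (dagger (inject R a x))) inject_isometry mul1mx.
  by rewrite mxtrace_mulC -KE; case: phi_ok => _ [].
have rhoE x : input_state x phi = W x *m dagger (W x).
  by rewrite input_stateE daggerM KE !mulmxA.
pose U := circ_unitary c.
have Uu : U \is unitarymx by apply: circ_upto_unitary.
have outE x v : out_prob c phi x v =
    complex.Re (frob (diagf (fun i => (bitn i 0 == v)%:R) *m (U *m W x))).
  by rewrite frob_proj /out_prob rhoE daggerM !mulmxA.
have out0 x v : 0 <= out_prob c phi x v.
  have := frob_ge0 (diagf (fun i => (bitn i 0 == v)%:R) *m (U *m W x)).
  by rewrite outE lecE => /andP[].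
have out1 x : out_prob c phi x true + out_prob c phi x false = 1.
  by rewrite !outE -raddfD (frob_proj_sum true) frob_unitary // fW.
pose g (x : bits n) : R := complex.Re (\tr (dagger B *m P1 *m B *m input_state x phi)).
have gE x : g x = complex.Re (frob (P1 *m (B *m W x))).
  have E : dagger (P1 *m (B *m W x)) *m (P1 *m (B *m W x)) =
      dagger (W x) *m (dagger B *m P1 *m B *m W x).
    by rewrite !daggerM P1d -!mulmxA (mulmxA P1 P1) P1P1.
  rewrite /g rhoE frobE E; congr complex.Re.
  by rewrite (mulmxA (dagger B *m P1 *m B)) mxtrace_mulC.
exists (D 0%N), g; split.
- exact: deg_le_jdeg_le.
- rewrite -div_beta // /D subn0; apply: le_trans (_ : 64 * tau%:R * m%:R / beta m d <= _).
    by rewrite truncn_le.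
  rewrite -mulrA ler_wpM2r //; first by rewrite divr_ge0 // ltW.
  by have := log_cap_le m0; rewrite -/tau; lra.
move=> x.
have close : `|out_prob c phi x true - g x| <= 4 * d%:R / n%:R.
  have -> : out_prob c phi x true = complex.Re (frob (P1 *m (circ_upto c d *m W x))).
    exact: outE.
  rewrite gE -raddfB -lecR.
  apply: le_trans (normc_ge_Re _) _.
  have h : contraction (2 ^ a) P1 by apply: contraction_proj.
  have := acirc_close c_ok (W x) b0 m0 mtau (leqnn d) h.
  rewrite fW mulr1 -/B distrC => hclose; apply: (le_trans hclose).
  have -> : ((4 * d%:R / n%:R : R)%:C)%C = 4 * d%:R / n%:R :> R[i].
    by rewrite !rmorphM fmorphV !rmorph_nat.
  rewrite ler_wpM2l ?mulr_ge0 // lef_pV2 ?posrE ?ltr0n // ler_nat.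
  by rewrite leq_addr.
have fp : `|(f x)%:R - out_prob c phi x true| <= delta.
  have := hf x; have := out1 x; case: (f x) => /= o1.
    by rewrite -o1 addrC addKr ger0_norm.
  by rewrite sub0r normrN ger0_norm.
by rewrite (le_trans (ler_distD (out_prob c phi x true) _ _)) // lerD.
Qed.
End ApproxDegree.

(** * Error reduction and the ancilla bound *)

Section Amplification.
Variable R : realType.

(** An odd cubic that fixes 1 and -1 with zero derivative there; iterating it pushes numbers towards
    their sign. *)
Definition amp (z : R) : R := (3 * z - z ^+ 3) / 2.

(** The factorization [E] shows that the distance to 1 shrinks by a factor of at most 1 - gamma / 2
    at each step; as amp y >= y on [0, 1], the iterates stay above [gamma]. *)
Lemma amp_iter (gamma z : R) (j : nat) : 0 < gamma -> gamma <= z <= 1 ->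
  gamma <= iter j amp z <= 1 /\ 1 - iter j amp z <= (1 - gamma / 2) ^+ j.
Proof.
move=> g0 /andP[gz z1].
elim: j => [|j [/andP[IH1 IH2] IH3]]; first by rewrite gz z1 expr0 /=; split=> //; lra.
rewrite iterS; set y := iter j amp z in IH1 IH2 IH3 *.
have E : 1 - amp y = (1 - y) * (1 - (y + y ^+ 2) / 2) by rewrite /amp; field.
have f0 : 0 <= 1 - (y + y ^+ 2) / 2 by rewrite expr2; nra.
have f1 : 1 - (y + y ^+ 2) / 2 <= 1 - gamma / 2 by rewrite expr2; nra.
have a1 : 0 <= 1 - amp y by rewrite E mulr_ge0 // subr_ge0.
have a2 : y <= amp y.
  rewrite -subr_ge0 (_ : amp y - y = y * (1 - y) * (1 + y) / 2); last by rewrite /amp; field.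
  by rewrite divr_ge0 // !mulr_ge0 //; lra.
split; first by lra.
by rewrite E [X in _ <= X]exprSr ler_pM // subr_ge0.
Qed.

Lemma ampN (z : R) : amp (- z) = - amp z.
Proof. by rewrite /amp; field. Qed.

Lemma iter_ampN (z : R) j : iter j amp (- z) = - iter j amp z.
Proof. by elim: j => //= j ->; rewrite ampN. Qed.

Lemma jdeg_le_amp n l (g : bits n -> R) j : jdeg_le l g ->
  jdeg_le (l * 3 ^ j) (fun x => iter j amp (g x)).
Proof.
move=> hg; elim: j => [|j IH]; first by rewrite muln1.
set L := (l * 3 ^ j)%N in IH.
have -> : (l * 3 ^ j.+1 = 0 + (L + (L + L)))%N by rewrite /L expnS; lia.
set y := fun x => iter j amp (g x) in IH.
apply: (@eq_jdeg_le _ _ _ (fun x => 2^-1 * (3 * y x + - 1 * (y x * (y x * y x))))).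
  by move=> x; rewrite iterS /amp -/(y x); field.
apply: jdeg_le_mul; first exact: jdeg_le_cst.
apply: jdeg_le_add.
  rewrite -[X in jdeg_le X]add0n; apply: jdeg_le_mul; first exact: jdeg_le_cst.
  by apply: jdeg_le_sub IH; rewrite leq_addr.
rewrite -[X in jdeg_le X]add0n; apply: jdeg_le_mul; first exact: jdeg_le_cst.
by do !apply: jdeg_le_mul.
Qed.

Lemma error_reduction (eps : R) : 0 <= eps -> eps < 1 / 2 ->
  exists J : nat, forall n l (f : bits n -> bool) (g : bits n -> R),
    jdeg_le l g -> (forall x, `|(f x)%:R - g x| <= eps) ->
    approx_deg_le (1 / 3) f ((l * J)%:R : R).
Proof.
(* Mapping g to (2 g - 1) / (1 + 2 eps) sends approximations of 1 into [gamma, 1] and those of 0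
   into [-1, -gamma]. Mapping back halves the error, hence the target 2 / 3 for a final error of 1 /
   3. *)
move=> e0 e1; pose gamma := (1 - 2 * eps) / (1 + 2 * eps).
have g0 : 0 < gamma by rewrite divr_gt0; lra.
have g1 : gamma <= 1 by rewrite ler_pdivrMr; lra.
have [j hj] : exists j : nat, (1 - gamma / 2) ^+ j <= 2 / 3.
  pose q := gamma / 2.
  have q0 : 0 < q by rewrite divr_gt0.
  pose j := (Num.truncn q^-1).+1; exists j.
  have jq : q^-1 < j%:R.
    by have /andP[] := truncn_itv (ltW (etrans (invr_gt0 q) q0)).
  rewrite -/q.
  (* A Bernoulli-type inequality; with j q >= 1 it gives (1 - q)^j <= 1 / 2. *)
  have bern i : (1 - q) ^+ i * (1 + i%:R * q) <= 1.
    elim: i => [|i IH]; first by rewrite mul1r mul0r addr0.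
    apply: le_trans IH; rewrite exprSr -mulrA ler_wpM2l ?exprn_ge0 //; first by rewrite /q; lra.
    rewrite -natr1 -subr_ge0.
    rewrite (_ : _ - _ = q * q * (i%:R + 1)); last by ring.
    by rewrite mulr_ge0 ?addr_ge0 // mulr_ge0 // ltW.
  have := bern j; have : 1 <= j%:R * q by rewrite -ler_pdivrMr // mul1r ltW.
  have : 0 <= (1 - q) ^+ j by rewrite exprn_ge0 // /q; lra.
  move: (j%:R * q) ((1 - q) ^+ j) => u v; nra.
exists (3 ^ j)%N => n l f g hg hf.
pose z x := (2 * g x - 1) / (1 + 2 * eps).
have hz : jdeg_le l z.
  apply: (@eq_jdeg_le _ _ _ (fun x => (2 / (1 + 2 * eps)) * g x + - (1 + 2 * eps)^-1)).
    by move=> x; rewrite /z; field; lra.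
  apply: jdeg_le_add; last exact: jdeg_le_cst.
  by rewrite -[l]add0n; apply: jdeg_le_mul hg; apply: jdeg_le_cst.
exists (fun x => 2^-1 * iter j amp (z x) + 2^-1); split.
  rewrite ler_nat; apply: fdeg_jdeg_le; apply: jdeg_le_add; last exact: jdeg_le_cst.
  rewrite -[X in jdeg_le X]add0n; apply: jdeg_le_mul; first exact: jdeg_le_cst.
  exact: jdeg_le_amp.
move=> x; have := hf x; case: (f x) => /=.
  rewrite ler_norml => /andP[h1 h2].
  have : gamma <= z x <= 1.
    by rewrite ler_pM2r ?invr_gt0 ?ler_pdivrMr; lra.
  move=> /(amp_iter j g0) [/andP[_ i1] i2].
  by rewrite ler_norml; lra.
rewrite sub0r normrN ler_norml => /andP[h1 h2].
have : gamma <= - z x <= 1.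
  by rewrite /z -mulNr ler_pM2r ?invr_gt0 ?ler_pdivrMr; lra.
move=> /(amp_iter j g0); rewrite iter_ampN => -[/andP[_ i1] i2].
by rewrite sub0r normrN ler_norml; lra.
Qed.
End Amplification.

(** * Asymptotic estimates with logarithms and real powers *)

Section Asymptotics.
Variable R : realType.

Lemma ln_le_subr1 (x : R) : 0 < x -> ln x <= x - 1.
Proof.
by move=> x0; rewrite -{1}(subrK 1 x) addrC; apply: le_ln1Dx; rewrite ltrBrDl subrr.
Qed.

(** With s = x^(theta / 4), ln s <= s - 1 gives 1 + ln x <= M s. Squaring leaves M^2 s^2, which is
    at most e s^4 = e x^theta once s^2 >= B = M^2 / e. *)
Lemma log_sqr_small (theta e : R) : 0 < theta -> 0 < e ->
  exists N : nat, forall n : nat, (N <= n)%N -> (0 < n)%N ->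
    (1 + ln n%:R) ^+ 2 <= e * powR n%:R theta.
Proof.
move=> t0 e0; pose M := 1 + 4 / theta; pose B := M ^+ 2 / e.
have t4 : 0 < 4 / theta by rewrite divr_gt0.
have M0 : 0 < M by rewrite addr_gt0.
have B0 : 0 < B by rewrite divr_gt0 // exprn_gt0.
exists (Num.truncn (powR B (2 / theta))).+1 => n Nn n0.
set x : R := n%:R; have x1 : 1 <= x by rewrite ler1n.
have x0 : 0 < x by apply: lt_le_trans x1.
pose s := powR x (theta / 4).
have s1 : 1 <= s.
  by rewrite -[1](powRr0 x) /s; apply: ler_powR => //; rewrite divr_ge0 // ltW.
have lnx : ln x = 4 / theta * ln s.
  by rewrite ln_powR; field; rewrite gt_eqF.
have L : 1 + ln x <= M * s.
  rewrite lnx (_ : M * s = s + 4 / theta * s) ?lerD //; last by rewrite /M; ring.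
  rewrite ler_wpM2l ?(ltW t4) //.
  by have := @ln_le_subr1 s; lra.
have L0 : 0 <= 1 + ln x by rewrite addr_ge0 // ln_ge0.
have sB : B <= s ^+ 2.
  rewrite -powR_mulrn ?powR_ge0 // -powRrM (_ : theta / 4 * 2%:R = theta / 2); last by field.
  have h : powR B (2 / theta) <= x.
    have /andP[_ h] := truncn_itv (powR_ge0 B (2 / theta)).
    by apply: le_trans (ltW h) _; rewrite ler_nat.
  have := @ge0_ler_powR R (theta / 2) (ltW (divr_gt0 t0 (ltr0n _ 2))) _ _
    (powR_ge0 _ _) (ltW x0) h.
  rewrite -powRrM (_ : 2 / theta * (theta / 2) = 1) ?powRr1 ?(ltW B0) //.
  by field; rewrite gt_eqF.
have -> : powR x theta = s ^+ 4.
  by rewrite -powR_mulrn ?powR_ge0 // -powRrM divfK ?pnatr_eq0.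
apply: (@le_trans _ _ ((M * s) ^+ 2)).
  by rewrite lerXn2r // nnegrE // (le_trans L0).
have s4 : s ^+ 4 = s ^+ 2 * s ^+ 2 by ring.
rewrite exprMn s4 mulrA.
have s0 : 0 <= s ^+ 2 by apply: le_trans sB; rewrite ltW.
by rewrite (ler_wpM2r s0) // mulrC -ler_pdivrMr.
Qed.

(** The hypothesis is raised to the power 1 + theta, which also covers theta = 1, where 1 / (1 -
    theta) is meaningless. As (1 - theta)(1 + theta) <= 1, this bounds n^(1 + theta) by a constant
    times L^2 (n + a), and half of the left side absorbs L^2 n by [log_sqr_small]. *)
Lemma ancilla_bound (theta K c0 : R) : 0 < theta <= 1 -> 0 < K -> 0 < c0 ->
  exists (c' : R) (N : nat), 0 < c' /\
    forall n a : nat, (N <= n)%N -> (0 < n)%N ->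
      c0 * n%:R <= K * (1 + ln ((n + a)%:R : R)) * powR ((n + a)%:R) (1 - theta) ->
      c' * powR n%:R (1 + theta) <= a%:R * (1 + ln n%:R) ^+ 2.
Proof.
move=> /andP[t0 t1] K0 c00; pose kappa := c0 / (2 * K).
have k0 : 0 < kappa by rewrite divr_gt0 // mulr_gt0.
pose c3 := powR kappa (1 + theta).
have c30 : 0 < c3 by rewrite powR_gt0.
have [N hN] := @log_sqr_small theta (c3 / 2) t0 (divr_gt0 c30 (ltr0n _ 2)).
exists (Num.min 1 (c3 / 2)), N; split; first by rewrite lt_min ltr01 divr_gt0.
move=> n a Nn n0; have := hN n Nn n0; rewrite natrD.
have : 1 <= n%:R :> R by rewrite ler1n.
have : 0 <= a%:R :> R by [].
move: (n%:R : R) (a%:R : R) => x A A0 x1 hL hc.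
have x0 : 0 < x by apply: lt_le_trans x1.
have lx0 : 0 <= ln x by rewrite ln_ge0.
set L := 1 + ln x in hL *; have L1 : 1 <= L by rewrite /L; lra.
have L0 : 0 < L by apply: lt_le_trans L1.
have P0 : 0 <= powR x (1 + theta) by apply: powR_ge0.
have xP : powR x (1 + theta) = x * powR x theta.
  by rewrite powRD ?powRr1 ?(ltW x0) ?(gt_eqF x0) ?implybT.
(* If a >= n^2 the conclusion is immediate; otherwise 1 + ln (n + a) is at most 2 L. *)
have [big|small] := leP (x ^+ 2) A.
  apply: (@le_trans _ _ (powR x (1 + theta))).
    by rewrite ler_piMl // ge_min lexx.
  apply: (@le_trans _ _ A).
    apply: le_trans big; rewrite -powR_mulrn ?(ltW x0) //.
    by apply: ler_powR => //; lra.
  by rewrite ler_peMr // exprn_ege1.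
set m := x + A in hc *; have m1 : 1 <= m by rewrite /m; lra.
have m0 : 0 < m by apply: lt_le_trans m1.
have lm : 1 + ln m <= 2 * L.
  have : ln m <= ln (2 * x ^+ 2).
    rewrite ler_ln ?posrE // ?mulr_gt0 ?exprn_gt0 //.
    have xx : x <= x ^+ 2 by rewrite expr2 ler_peMr // ltW.
    by rewrite /m; lra.
  rewrite lnM ?posrE ?exprn_gt0 // lnXn // mulr2n.
  have : ln 2 <= 2 - 1 :> R by apply: ln_le_subr1.
  by rewrite /L; lra.
have hy : kappa * x <= L * powR m (1 - theta).
  rewrite /kappa mulrAC ler_pdivrMr ?mulr_gt0 //; apply: le_trans hc _.
  rewrite (_ : L * _ * (2 * K) = K * (2 * L) * powR m (1 - theta)); last by ring.
  by rewrite ler_wpM2r ?powR_ge0 // ler_wpM2l // ltW.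
have tp : 0 <= 1 + theta by lra.
have kx0 : 0 <= kappa * x by rewrite ltW // mulr_gt0.
have := @ge0_ler_powR R (1 + theta) tp _ _ kx0 (le_trans kx0 hy) hy.
rewrite (powRM _ (ltW k0) (ltW x0)) (powRM _ (ltW L0) (powR_ge0 _ _)).
rewrite -powRrM -/c3 => h.
have h1 : powR L (1 + theta) <= L ^+ 2.
  by rewrite -powR_mulrn ?(ltW L0) //; apply: ler_powR => //; lra.
have h2 : powR m ((1 - theta) * (1 + theta)) <= m.
  by apply: ler1_powR => //; nra.
have h3 : c3 * powR x (1 + theta) <= L ^+ 2 * m.
  by apply: le_trans h _; apply: ler_pM; rewrite ?powR_ge0.
have h4 : x * L ^+ 2 <= c3 / 2 * powR x (1 + theta).
  by rewrite xP (mulrCA (c3 / 2)) ler_wpM2l // ltW.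
apply: (@le_trans _ _ (c3 / 2 * powR x (1 + theta))).
  by rewrite ler_wpM2r // ge_min lexx orbT.
move: h3 h4; rewrite /m mulrDr (mulrC _ x) (mulrC _ A).
by move: (x * _) (A * _) (powR _ _) => u v w; lra.
Qed.
End Asymptotics.

Theorem theorem4p3 (R : realType) :
  (* Part 1: deg_{delta + O(d/n)}(f) = O~((n + a)^(1 - 3^-d)),
     with absolute constants C1, C2 and polylog exponent k. *)
  (exists (C1 C2 : R) (k : nat),
    forall (n a d : nat) (phi : 'M[R[i]]_(2 ^ a)) (c : qac0 R (n + a) d)
           (f : bits n -> bool) (delta : R),
      (0 < n)%N ->
      is_state phi ->
      qac0_ok c ->
      computes_with_error c phi f delta ->
      approx_deg_le (delta + C1 * d%:R / n%:R) f
        (C2 * (1 + ln ((n + a)%:R : R)) ^+ k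
            * powR ((n + a)%:R : R) (1 - ((3 ^ d)%:R)^-1)))
  /\
  (* Part 2: ancilla lower bound a_n = Omega~(n^(1 + 3^-d)). *)
  (forall (d : nat) (delta0 : R) (f : forall n, bits n -> bool) (a : nat -> nat),
    delta0 < 1 / 2 ->
    (exists c : R, 0 < c /\ exists N : nat, forall n : nat, (N <= n)%N ->
       forall B : R, approx_deg_le (1 / 3) (f n) B -> c * n%:R <= B) ->
    (forall n : nat, (0 < n)%N ->
       exists (phi : 'M[R[i]]_(2 ^ a n)) (c : qac0 R (n + a n) d),
         is_state phi /\ qac0_ok c /\ computes_with_error c phi (f n) delta0) ->
    exists (c' : R) (k N : nat), 0 < c' /\
      forall n : nat, (N <= n)%N ->
        c' * powR (n%:R : R) (1 + ((3 ^ d)%:R)^-1)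
          <= (a n)%:R * (1 + ln (n%:R : R)) ^+ k).
Proof.
split.
  exists 4, 128, 1%N => n a d phi c f delta n0 hphi hc hf.
  have [l [g [hl lB hg]]] := circuit_approx n0 hphi hc hf.
  exists g; split=> //; apply: le_trans lB.
  by rewrite ler_nat fdeg_jdeg_le.
move=> d delta0 f a d0 [c0 [c00 [N0 hdeg]]] hcirc.
(* Halfway between the given error and 1 / 2, which leaves the gap eps - delta0 for the term 4 d /
   n; the maximum with 0 ensures eps >= 0. *)
pose eps : R := (Num.max 0 delta0 + 1 / 2) / 2.
have [e1 e2 e3] : [/\ 0 <= eps, eps < 1 / 2 & 0 < eps - delta0].
  by rewrite /eps; case: (leP 0 delta0) => h; split; lra.
have [J hJ] := error_reduction e1 e2.
(* The successor makes the constant positive whatever [J] is. *)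
have K0 : 0 < 128 * J.+1%:R :> R by rewrite mulr_gt0.
have theta01 : 0 < ((3 ^ d)%:R^-1 : R) <= 1.
  have p3 : 0 < (3 ^ d)%:R :> R by rewrite ltr0n expn_gt0.
  by rewrite invr_gt0 p3 invf_le1 // ler1n expn_gt0.
have [c' [N [c'0 hN]]] := ancilla_bound theta01 K0 c00.
(* From [N1] on, 4 d / n fits into the gap eps - delta0. *)
pose N1 := (Num.truncn (4 * d%:R / (eps - delta0))).+1.
exists c', 2%N, (maxn 1 (maxn N0 (maxn N N1))); split=> // n.
rewrite !geq_max => /and4P[n0 nN0 nN nN1]; apply: hN => //.
have [phi [c [hphi [hc hf]]]] := hcirc n n0.
have [l [g [hl lB hg]]] := circuit_approx n0 hphi hc hf.
have {}hg x : `|(f n x)%:R - g x| <= eps.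
  apply: le_trans (hg x) _; rewrite -lerBrDl ler_pdivrMr ?ltr0n //.
  rewrite (mulrC (eps - delta0)) -ler_pdivrMr //.
  have /andP[_ h] : (Num.truncn (4 * d%:R / (eps - delta0)))%:R <=
      4 * d%:R / (eps - delta0) < N1%:R.
    by apply: truncn_itv; rewrite divr_ge0 ?mulr_ge0 // ltW.
  by apply: le_trans (ltW h) _; rewrite ler_nat.
apply: le_trans (hdeg n nN0 _ (hJ _ _ _ _ hl hg)) _.
rewrite natrM mulrC -!mulrA [leRHS]mulrCA; apply: ler_pM => //.
  by rewrite ler_nat.
by rewrite mulrA.
Qed.
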